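(* Let $N,n\ge1$ and let $L$ be a measurable function of $(\rho^\ell,\tau^\ell)_{1\le\ell\le n}\in(\Sigma_N\times\Sigma_N)^n$ with $\|L\|_\infty\le1$. The following two statements hold. 1. Suppose that $\beta_{1,2}=\beta_{1,3}=\beta_{2,2}=\beta_{2,3}=0$ and $y$ has mean zero and variance one with $\mathbb{E}|y|^3<\infty$. Then $$|\mathbb{E}\langle L\rangle_g-\mathbb{E}\langle L\rangle_y|\le\frac{3nC_{2,2n}\,\mathbb{E}|y|^3}{N^{1/2}}\sum_{p\ge4}(\beta_{1,p}+\beta_{2,p})^3 .$$ 2. Suppose that the first four moments of $y$ match the first four moments of a standard Gaussian random variable. Then $$|\mathbb{E}\langle L\rangle_g-\mathbb{E}\langle L\rangle_y|\le 4nC_{3,2n}\,\mathbb{E}\big[|y|^4;|y|\ge N^{1/4}\big]\sum_{p\ge2}(\beta_{1,p}+\beta_{2,p})^4+\frac{5nC_{4,2n}\,\mathbb{E}|y|^4}{12N^{1/4}}\sum_{p\ge2}(\beta_{1,p}+\beta_{2,p})^5 .$$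
   Context: Let $\Sigma_N=\{-1,1\}^N$, let $(\beta_{1,p})_{p\ge2}$ and $(\beta_{2,p})_{p\ge2}$ be nonnegative sequences with $\sum_{p\ge2}2^p\beta_{1,p}^2<\infty$ and $\sum_{p\ge2}2^p\beta_{2,p}^2<\infty$, let $h_1,h_2\in\mathbb{R}$, and let $(t_p)_{p\ge2}\subset[0,1]$. Let $y_{i_1,\ldots,i_p}$, $y_{1,i_1,\ldots,i_p}$, $y_{2,i_1,\ldots,i_p}$ ($p\ge2$, $1\le i_1,\ldots,i_p\le N$) be independent, identically distributed random variables with common law that of a random variable $y$ with mean zero and variance one. Put $$X_p(\sigma)=\frac{1}{N^{(p-1)/2}}\sum_{1\le i_1,\ldots,i_p\le N}y_{i_1,\ldots,i_p}\sigma_{i_1}\cdots\sigma_{i_p},\qquad X_{j,p}(\sigma)=\frac{1}{N^{(p-1)/2}}\sum_{1\le i_1,\ldots,i_p\le N}y_{j,i_1,\ldots,i_p}\sigma_{i_1}\cdots\sigma_{i_p}\ (j=1,2).$$ The two coupled mixed $p$-spin Hamiltonians on $\Sigma_N$ are $$X_1(\rho)=\sum_{p\ge2}\beta_{1,p}\big(\sqrt{t_p}X_p(\rho)+\sqrt{1-t_p}X_{1,p}(\rho)\big)+h_1\sum_{i=1}^N\rho_i,$$ $$X_2(\tau)=\sum_{p\ge2}\beta_{2,p}\big(\sqrt{t_p}X_p(\tau)+\sqrt{1-t_p}X_{2,p}(\tau)\big)+h_2\sum_{i=1}^N\tau_i,$$ with Gibbs measures $G_1(\rho)=e^{X_1(\rho)}/Z_1$,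 $G_2(\tau)=e^{X_2(\tau)}/Z_2$ ($Z_1,Z_2$ the normalizing sums over $\Sigma_N$). $\langle\cdot\rangle_y$ denotes the expectation over i.i.d. samples $(\rho^\ell,\tau^\ell)_{\ell\ge1}$ from $G_1\times G_2$, conditionally on the disorder; $\langle\cdot\rangle_g$ is the same object when all disorder variables are i.i.d. standard Gaussian. $\mathbb{E}$ is the expectation over the disorder, $\mathbb{E}[X;A]=\mathbb{E}[X\mathbf 1_A]$, and $C_{k,m}:=2^{k(k+1)/2}m^k$. *)

(* Defs.v *)
From HB Require Import structures.
From mathcomp Require Export all_boot all_order all_algebra finmap.
From mathcomp Require Export all_classical all_reals all_analysis.

Set Implicit Arguments.
Unset Strict Implicit.
Unset Printing Implicit Defensive.

Import Order.TTheory GRing.Theory Num.Theory.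
Import numFieldNormedType.Exports.

Local Open Scope classical_set_scope.
Local Open Scope ring_scope.

Definition mutually_independent d (T : measurableType d) (R : realType)
    (P : probability T R) (I : choiceType) (D : set I)
    (Y : I -> {RV P >-> R}) : Prop :=
  forall (J : {fset I}) (B : I -> set R),
    [set` J] `<=` D -> (forall i, measurable (B i)) ->
    P (\bigcap_(i in [set` J]) (Y i @^-1` B i)) =
    (\prod_(i <- J) P (Y i @^-1` B i))%E.

(* The configuration [s] has spins [(-1) ^+ s i], so that [false] encodes the
   spin 1 and [true] the spin -1. *)
Definition config (N : nat) := {ffun 'I_N -> bool}.

Definition spin (R : realType) (N : nat) (s : config N) (i : 'I_N) : R :=
  (-1) ^+ s i.

(* [(None, [:: i_1; ..; i_p])] indexes the variable y_{i_1,..,i_p} shared by the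
   two systems; [Some false] and [Some true] in place of [None] give
   y_{1,i_1,..,i_p} and y_{2,i_1,..,i_p}. *)
Definition site (N : nat) := (option bool * seq 'I_N)%type.

(* Only multi-indices of length p >= 2 carry disorder; the variables of a
   family at the other indices are never used and are left unconstrained. *)
Definition active (N : nat) : set (site N) := [set i | (2 <= size i.2)%N].

Definition iid_disorder d (T : measurableType d) (R : realType)
    (P : probability T R) (N : nat) (Y : site N -> {RV P >-> R})
    (law : set R -> \bar R) : Prop :=
  mutually_independent (@active N) Y /\
  forall i, active i ->
    forall B, measurable B -> distribution P (Y i) B = law B.

Section model.
Variables (R : realType) (N : nat).
(* one realization of the disorder *)
Variable x : site N -> R.

Definition pure_hamiltonian (c : option bool) (p : nat) (s : config N) : R :=
  (N%:R `^ ((p%:R - 1) / 2))^-1 *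
  \sum_(i : p.-tuple 'I_N) x (c, tval i) * \prod_(k <- i) spin R s k.

(* [j = false] is the first system and [j = true] the second.  The series over p
   is a limit of partial sums; when [x] is random it converges almost surely
   under the summability assumption on [beta], and [limn] takes a junk value on
   the exceptional null set. *)
Definition hamiltonian (t : nat -> R) (j : bool) (beta : nat -> R) (h : R)
    (s : config N) : R :=
  limn (fun m => \sum_(2 <= p < m) beta p *
    (Num.sqrt (t p) * pure_hamiltonian None p s +
     Num.sqrt (1 - t p) * pure_hamiltonian (Some j) p s)) +
  h * \sum_(i < N) spin R s i.

Definition gibbs (H : config N -> R) (s : config N) : R :=
  expR (H s) / \sum_(s' : config N) expR (H s').

(* <L> for a function L of the first n replica pairs *)
Definition gibbs_mean (t beta1 beta2 : nat -> R) (h1 h2 : R) (n : nat)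
    (L : {ffun 'I_n -> config N * config N} -> R) : R :=
  \sum_(r : {ffun 'I_n -> config N * config N})
    L r * \prod_(l < n) (gibbs (hamiltonian t false beta1 h1) (r l).1 *
                         gibbs (hamiltonian t true beta2 h2) (r l).2).

End model.

Definition Ccst (k m : nat) : nat := (2 ^ (k * k.+1)./2 * m ^ k)%N.

(* Main.v *)
Require Import Defs.
From HB Require Import structures.
From mathcomp Require Import measurable_realfun ring lra zify.

Set Implicit Arguments.
Unset Strict Implicit.
Unset Printing Implicit Defensive.

Import Order.TTheory GRing.Theory Num.Theory.
Import numFieldNormedType.Exports.

Local Open Scope classical_set_scope.
Local Open Scope ring_scope.

(** The proof is Lindeberg's replacement method: the disorder variables are
    changed from [Y] to [G] one at a time, and each change is cheap because the
    two laws have several moments in common.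

    Keep only the disorder variables whose multi-index is shorter than a cutoff
    [m].  The energy of a pair of configurations is then a finite linear form in
    the disorder ([truncated_hamiltonian_linear]), and the product of the two
    Gibbs measures is a single Boltzmann weight on pairs ([boltzmann_pair]).  As a
    function of one disorder variable [u] the energy is [E + u * k], so the Gibbs
    average of [L] is a function [f u] of one real variable.  Differentiating an
    average over [n] replicas gives an average over [n.+1] replicas
    ([is_derive_replica_mean]); iterating, the [j]-th derivative of [f] is at most
    [(2 n |k|)^j j!].  The factorial cancels the one in Taylor's formula, and [f]
    differs from its Taylor polynomial of degree below [K] by at most
    [(2 n |k u|)^K] ([taylor_replica_mean]).

    The coefficients of this polynomial depend on the other variables only.  By
    independence the expectation of the term of degree [j] is the mean of the
    coefficient times the [j]-th moment of the variable ([expectation_expansion]).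
    If the two laws share these moments, one replacement costs at most the means
    of the two remainders, and the whole replacement costs their sum over the
    sites ([lindeberg]).  The two disorders may live on different spaces, so the
    intermediate families, which take some members from each, are built on the
    product of the two spaces ([mixed_independent]).

    It remains to count.  Level [p] has [N^p] variables in each family, each with
    a coupling of order [N^(-(p-1)/2)], so the [q]-th powers of the couplings add
    up to [N^(p - q (p-1)/2)] times a power of the inverse temperatures
    ([sum_level_coef_bound], [level_weight]).  For the first part [q = 3], and the
    exponent is at most [-1/2] once [p >= 4].  The third absolute moment of the
    Gaussian is at most 2, while that of [y] is at least 1.  For the second part
    the remainder of order four is at most both [v^5] and [2 v^4], with
    [v = 2 n |k u|].  The fifth power is used where [|y| < N^(1/4)], where
    [|y|^5 <= N^(1/4) |y|^4], and the fourth power elsewhere.  The exponents for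
    [q = 5] and [q = 4] are at most [-1/2] and [0] for all [p >= 2].  The constants
    obtained, [24 n^3], [32 n^4] and [128 n^5], are below the stated ones.

    Finally the cutoff is removed.  Distinct disorder variables are uncorrelated,
    so a pure Hamiltonian has variance [N] and mean absolute value at most [1 + N]
    ([pure_hamiltonian_mean]); the hypothesis on the inverse temperatures makes
    them summable, so the Hamiltonians converge almost surely
    ([ae_hamiltonian_cvg]), and the Gibbs averages, which are bounded by 1,
    converge in mean ([cvg_truncated_mean]).  The bounds do not depend on the
    cutoff and pass to the limit. *)

(** * Pointwise calculus rules *)

Section pointwise_derivatives.
Variable R : realType.
Implicit Types (f g : R -> R) (x a b c : R).

Lemma is_derive_ptD f g x a b : is_derive x 1 f a -> is_derive x 1 g b ->
  is_derive x 1 (fun y => f y + g y) (a + b).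
Proof. by move=> fa gb; exact: is_deriveD. Qed.

Lemma is_derive_ptB f g x a b : is_derive x 1 f a -> is_derive x 1 g b ->
  is_derive x 1 (fun y => f y - g y) (a - b).
Proof. by move=> fa gb; exact: is_deriveB. Qed.

Lemma is_derive_ptM f g x a b : is_derive x 1 f a -> is_derive x 1 g b ->
  is_derive x 1 (fun y => f y * g y) (a * g x + f x * b).
Proof.
by move=> fa gb; apply: (is_derive_eq (is_deriveM fa gb)); rewrite addrC mulrC.
Qed.

Lemma is_derive_ptMl c f x a : is_derive x 1 f a ->
  is_derive x 1 (fun y => c * f y) (c * a).
Proof. by move=> fa; exact: (@is_deriveZ R R R f c x 1 a). Qed.

Lemma is_derive_monomial c n x :
  is_derive x 1 (fun y : R => c * y ^+ n) (c * (n%:R * x ^+ n.-1)).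
Proof.
apply: is_derive_ptMl; have -> : (fun y : R => y ^+ n) = id ^+ n by rewrite exprfctE.
by apply: is_derive_eq; rewrite /GRing.scale/= mulr1.
Qed.

Lemma is_derive_pt_sum (I : Type) (r : seq I) (f : I -> R -> R) x (a : I -> R) :
  (forall i, is_derive x 1 (f i) (a i)) ->
  is_derive x 1 (fun y => \sum_(i <- r) f i y) (\sum_(i <- r) a i).
Proof.
move=> fa; elim: r => [|i r IH].
  by under eq_fun do rewrite big_nil; rewrite big_nil; exact: is_derive_cst.
under eq_fun do rewrite big_cons.
by rewrite big_cons; exact: is_derive_ptD.
Qed.

Lemma is_derive_pt_expR f x a : is_derive x 1 f a ->
  is_derive x 1 (fun y => expR (f y)) (expR (f x) * a).
Proof. by move=> fa; exact: (is_derive1_comp (is_derive_expR _) fa). Qed.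

End pointwise_derivatives.

(** * A Taylor bound from a bound on the last derivative *)

(** Integrating a bound of order [k] gives one of order [k.+1], without an
    integral: on the half-line of nonnegative reals, the difference
    [D v^(k+1) / (k+1)! - g v] has a nonnegative derivative.  Applying this to [g]
    and [- g], and to [v |-> g (- v)], covers both signs. *)
Lemma le_primitive_pow (R : realType) (g g' : R -> R) (D : R) k :
  (forall v : R, is_derive v 1 g (g' v)) -> g 0 = 0 ->
  (forall v, `|g' v| <= D * `|v| ^+ k / k`!%:R) ->
  forall u, `|g u| <= D * `|u| ^+ k.+1 / k.+1`!%:R.
Proof.
move=> dg g0 hg.
have pos (h h' : R -> R) : (forall v : R, is_derive v 1 h (h' v)) -> h 0 = 0 ->
    (forall v : R, 0 < v -> h' v <= D * `|v| ^+ k / k`!%:R) ->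
    forall u : R, 0 <= u -> h u <= D * `|u| ^+ k.+1 / k.+1`!%:R.
  move=> dh h0 hh u u0.
  pose q v := D / k.+1`!%:R * v ^+ k.+1 - h v.
  have dq (v : R) : is_derive v 1 q (D * v ^+ k / k`!%:R - h' v).
    apply: (is_derive_eq (is_derive_ptB (is_derive_monomial _ _ _) (dh v))).
    rewrite factS natrM invfM.
    have kn0 : (k.+1%:R : R) != 0 by rewrite pnatr_eq0.
    have kf : k`!%:R != 0 :> R by rewrite pnatr_eq0 -lt0n fact_gt0.
    by congr (_ - _); rewrite [_.+1.-1]/=; field; rewrite kf addrC natr1 kn0.
  have : q 0 <= q u.
    apply: (@ger0_derive1_ndecr R q 0 u) => //.
    - move=> x; rewrite in_itv/= => /andP[x0 _].
      rewrite derive1E (@derive_val _ _ _ _ _ _ _ (dq x)) subr_ge0.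
      by have := hh x x0; rewrite gtr0_norm.
    - apply: continuous_subspaceT => x.
      by apply: differentiable_continuous; apply/derivable1_diffP; have [] := dq x.
  by rewrite {1}/q h0 expr0n mulr0 subr0 /q subr_ge0 ger0_norm// mulrAC.
have abs (h h' : R -> R) : (forall v : R, is_derive v 1 h (h' v)) -> h 0 = 0 ->
    (forall v, `|h' v| <= D * `|v| ^+ k / k`!%:R) ->
    forall u : R, 0 <= u -> `|h u| <= D * `|u| ^+ k.+1 / k.+1`!%:R.
  move=> dh h0 hh w w0; rewrite ler_norml; apply/andP; split; last first.
    by apply: (pos h h') => // v _; rewrite (le_trans (ler_norm _)).
  rewrite lerNl; apply: (pos (fun v => - h v) (fun v => - h' v)) => //.
    by rewrite h0 oppr0.
  by move=> v _; rewrite (le_trans (ler_norm _))// normrN.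
move=> u; have [u0|u0] := leP 0 u; first exact: (abs g g').
have := abs (fun v => g (- v)) (fun v => - g' (- v)) _ _ _ (- u).
rewrite opprK normrN; apply.
- move=> v; rewrite -mulrN1.
  exact: (is_derive1_comp (dg (- v)) (is_deriveNid v (1 : R))).
- by rewrite oppr0.
- by move=> v; rewrite normrN; have := hg (- v); rewrite normrN.
- by rewrite oppr_ge0 ltW.
Qed.

(** Induction on [K]: the derivative of the remainder of [f 0] is the remainder of
    order [K - 1] of [f 1], and the remainder vanishes at zero. *)
Lemma taylor_bound (R : realType) (D : R) K (f : nat -> R -> R) :
  (forall k, (k < K)%N -> forall v : R, is_derive v 1 (f k) (f k.+1 v)) ->
  (forall v, `|f K v| <= D) ->
  forall u, `|f 0%N u - \sum_(j < K) f j 0 / j`!%:R * u ^+ j|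
    <= D * `|u| ^+ K / K`!%:R.
Proof.
elim: K f => [|K IH] f df fK u.
  by rewrite big_ord0 subr0 expr0 mulr1 divr1.
apply: (le_primitive_pow
  (g := fun u => f 0%N u - \sum_(j < K.+1) f j 0 / j`!%:R * u ^+ j)
  (g' := fun u => f 1%N u - \sum_(j < K) f j.+1 0 / j`!%:R * u ^+ j)).
- move=> v; apply: (is_derive_eq (is_derive_ptB (df 0%N (ltn0Sn _) v)
    (is_derive_pt_sum (f := fun (j : 'I_K.+1) u => f j 0 / j`!%:R * u ^+ j) _
      (fun j => is_derive_monomial _ j v)))).
  rewrite big_ord_recl/= mul0r mulr0 add0r; congr (_ - _).
  apply: eq_bigr => i _; rewrite factS natrM invfM.
  have kn0 : (i.+1%:R : R) != 0 by rewrite pnatr_eq0.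
  have kf : i`!%:R != 0 :> R by rewrite pnatr_eq0 -lt0n fact_gt0.
  by rewrite /bump/= add1n; field; rewrite kf addrC natr1 kn0.
- rewrite big_ord_recl/= expr0 mulr1 divr1 big1 ?addr0 ?subrr// => i _.
  by rewrite expr0n mulr0.
- move=> v; apply: (IH (fun k => f k.+1)) => // k kK w; exact: df.
Qed.

(** * Gibbs averages under an affine perturbation of the energy *)

Section boltzmann.
Variables (R : realType) (S : finType).
Implicit Types (E c : S -> R) (g : S -> R) (s : S).

Definition boltzmann E s : R := expR (E s) / \sum_s' expR (E s').

(** The average of [L] over [n] independent replicas drawn from the weight [g]. *)
Definition replica_mean n (L : {ffun 'I_n -> S} -> R) g : R :=
  \sum_r L r * \prod_(l < n) g (r l).

Lemma partition_gt0 E s : 0 < \sum_s' expR (E s').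
Proof.
by rewrite (bigD1 s)//= ltr_wpDr ?expR_gt0// sumr_ge0.
Qed.

Lemma boltzmann_ge0 E s : 0 <= boltzmann E s.
Proof. by rewrite divr_ge0 ?expR_ge0// ltW// (partition_gt0 _ s). Qed.

Lemma boltzmann_sum1 E s : \sum_s' boltzmann E s' = 1.
Proof. by rewrite -mulr_suml divff// gt_eqF// (partition_gt0 _ s). Qed.

(** The logarithmic derivative of the numerator is [c s], that of the partition
    function is the Gibbs average of [c]. *)
Lemma is_derive_boltzmann E c s (u : R) :
  is_derive u 1 (fun u : R => boltzmann (fun s => E s + u * c s) s)
    (boltzmann (fun s => E s + u * c s) s *
     (c s - \sum_s' c s' * boltzmann (fun s => E s + u * c s) s')).
Proof.
have dE s' : is_derive u 1 (fun u : R => expR (E s' + u * c s'))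
    (expR (E s' + u * c s') * c s').
  apply: is_derive_pt_expR.
  apply: is_derive_eq (is_derive_ptD (is_derive_cst (E s') u (1 : R))
    (is_derive_ptM (is_derive_id u (1 : R)) (is_derive_cst (c s') u (1 : R)))) _.
  by rewrite add0r mul1r mulr0 addr0.
pose Z (u : R) := \sum_s' expR (E s' + u * c s').
have dZ : is_derive u 1 Z _ := is_derive_pt_sum _ dE.
have Z0 : Z u != 0.
  by rewrite gt_eqF// (partition_gt0 (fun s => E s + u * c s) s).
apply: is_derive_eq (is_derive_ptM (dE s) (is_deriveV Z0 dZ)) _.
rewrite /boltzmann -/(Z u).
under [in RHS]eq_bigr do rewrite mulrA.
rewrite -mulr_suml [X in (_ - X / _)](_ : _ =
  \sum_s' expR (E s' + u * c s') * c s'); last first.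
  by apply: eq_bigr => i _; rewrite mulrC.
by rewrite /GRing.scale/=; field.
Qed.

Lemma replica_mean_prob n g : \sum_s g s = 1 ->
  \sum_(r : {ffun 'I_n -> S}) \prod_(l < n) g (r l) = 1.
Proof.
by move=> g1; rewrite -(bigA_distr_bigA (fun _ => g)) big1.
Qed.

Lemma replica_mean_bound n (L : {ffun 'I_n -> S} -> R) g (B : R) :
  (forall s, 0 <= g s) -> \sum_s g s = 1 -> (forall r, `|L r| <= B) ->
  `|replica_mean L g| <= B.
Proof.
move=> g0 g1 LB; apply: (le_trans (ler_norm_sum _ _ _)).
rewrite -[leRHS]mulr1 -[X in _ <= _ * X](replica_mean_prob n g1)
  mulr_sumr ler_sum// => r _.
rewrite normrM [X in _ * X]ger0_norm ?prodr_ge0//.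
by rewrite ler_wpM2r// prodr_ge0.
Qed.

(** The new replica is placed last: [extend] appends it and [restrict_init]
    forgets it. *)
Definition extend n (r : {ffun 'I_n -> S}) s : {ffun 'I_n.+1 -> S} :=
  [ffun i => if unlift ord_max i is Some j then r j else s].

Definition restrict_init n (r : {ffun 'I_n.+1 -> S}) : {ffun 'I_n -> S} :=
  [ffun i => r (lift ord_max i)].

Lemma replica_mean_recr n (L : {ffun 'I_n.+1 -> S} -> R) g :
  replica_mean L g =
  \sum_(r : {ffun 'I_n -> S}) \sum_s L (extend r s) * ((\prod_(l < n) g (r l)) * g s).
Proof.
rewrite /replica_mean.
rewrite (reindex (fun p : {ffun 'I_n -> S} * S => extend p.1 p.2)) /=; last first.
  exists (fun r => (restrict_init r, r ord_max)) => [[r s]|r] _ /=.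
    congr (_, _); last by rewrite ffunE unlift_none.
    by apply/ffunP => i; rewrite !ffunE liftK.
  apply/ffunP => i; rewrite ffunE; case: unliftP => [j ->|->//].
  by rewrite ffunE.
rewrite pair_big/=; apply: eq_bigr => -[r s] _ /=; congr (_ * _).
rewrite big_ord_recr/=; congr (_ * _); last by rewrite ffunE unlift_none.
apply: eq_bigr => i _; rewrite ffunE.
have -> : widen_ord (leqnSn n) i = lift ord_max i.
  by apply: val_inj; rewrite /= /bump leqNgt ltn_ord add0n.
by rewrite liftK.
Qed.

(** Each of the [n] weights contributes [c (r l)] minus the average of [c].  The
    [n] averages are read off a single further replica [r ord_max], which turns
    the derivative into an average over [n.+1] replicas. *)
Definition replica_deriv c n (L : {ffun 'I_n -> S} -> R) :
    {ffun 'I_n.+1 -> S} -> R :=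
  fun r => L (restrict_init r) *
    (\sum_l c (restrict_init r l) - n%:R * c (r ord_max)).

Lemma replica_mean_deriv c n (L : {ffun 'I_n -> S} -> R) g : \sum_s g s = 1 ->
  replica_mean (replica_deriv c L) g =
  \sum_r L r * ((\prod_(l < n) g (r l)) *
                (\sum_l (c (r l) - \sum_s c s * g s))).
Proof.
move=> g1; rewrite replica_mean_recr; apply: eq_bigr => r _.
have rr s : restrict_init (extend r s) = r.
  by apply/ffunP => i; rewrite !ffunE liftK.
under eq_bigr do rewrite /replica_deriv rr [extend _ _ _]ffunE unlift_none.
rewrite sumrB sumr_const card_ord.
set m := \sum_s c s * g s; set A := \sum_l c (r l); set Q := \prod_l _.
transitivity (\sum_s (L r * Q * A * g s - L r * Q * (n%:R * (c s * g s)))).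
  by apply: eq_bigr => s _; ring.
by rewrite sumrB -!mulr_sumr g1 -/m -[m *+ n]mulr_natl; ring.
Qed.

Lemma replica_deriv_bound c n (L : {ffun 'I_n -> S} -> R) (B M : R) :
  (forall r, `|L r| <= B) -> (forall s, `|c s| <= M) ->
  forall r, `|replica_deriv c L r| <= B * (2 * n%:R * M).
Proof.
move=> LB cM r; rewrite normrM ler_pM//.
rewrite (le_trans (ler_normB _ _))//.
rewrite (_ : 2 * n%:R * M = n%:R * M + n%:R * M); last by ring.
rewrite lerD//.
  rewrite (le_trans (ler_norm_sum _ _ _))//.
  by rewrite (le_trans (ler_sum _ (fun l _ => cM _)))// sumr_const card_ord mulr_natl.
by rewrite normrM ger0_norm// ler_wpM2l.
Qed.

(** Stated with logarithmic derivatives [h i], the form in which the derivative of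
    a Boltzmann weight is known. *)
Lemma is_derive_prod (I : finType) (f : I -> R -> R) (h : I -> R) (u : R) :
  (forall i, is_derive u 1 (f i) (f i u * h i)) ->
  is_derive u 1 (fun u => \prod_i f i u) ((\prod_i f i u) * \sum_i h i).
Proof.
move=> fh; elim: (index_enum I) => [|i r IH].
  under eq_fun do rewrite big_nil.
  by rewrite !big_nil mulr0; exact: is_derive_cst.
under eq_fun do rewrite big_cons.
rewrite !big_cons; apply: is_derive_eq (is_derive_ptM (fh i) IH) _.
by ring.
Qed.

Lemma is_derive_replica_mean E c n (L : {ffun 'I_n -> S} -> R) (u : R) s :
  is_derive u 1
    (fun u : R => replica_mean L (boltzmann (fun s => E s + u * c s)))
    (replica_mean (replica_deriv c L) (boltzmann (fun s => E s + u * c s))).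
Proof.
rewrite replica_mean_deriv ?(boltzmann_sum1 _ s)//.
apply: is_derive_pt_sum => r; apply: is_derive_ptMl.
by apply: is_derive_prod => l; exact: is_derive_boltzmann.
Qed.

(** The derivative of order [k], as a function of [k + n] replicas. *)
Fixpoint replica_derivn c k n :
    ({ffun 'I_n -> S} -> R) -> {ffun 'I_(k + n) -> S} -> R :=
  if k is k'.+1 then fun L => replica_deriv c (@replica_derivn c k' n L)
  else id.
Arguments replica_derivn c k {n} L _.

(** Step [j] differentiates a function of [n + j] replicas and multiplies the bound
    by [2 (n + j) M], which is at most [2 n (j + 1) M]; the factors [j + 1] build
    the factorial. *)
Lemma replica_derivn_bound c k n (L : {ffun 'I_n -> S} -> R) (M : R) :
  (1 <= n)%N ->
  (forall r, `|L r| <= 1) -> (forall s, `|c s| <= M) ->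
  forall r, `|replica_derivn c k L r| <= (2 * n%:R * M) ^+ k * k`!%:R.
Proof.
move=> n1 L1 cM; elim: k => [|k IH] r; first by rewrite mulr1 expr0 L1.
have M0 : 0 <= M := le_trans (normr_ge0 _) (cM (r ord_max)).
apply: (le_trans (replica_deriv_bound IH cM r)).
have h : 2 * (k + n)%:R * M <= 2 * n%:R * M * k.+1%:R.
  rewrite -!mulrA ler_wpM2l// mulrCA [leLHS]mulrC ler_wpM2l// -natrM ler_nat.
  by rewrite mulnS addnC leq_add2l leq_pmull.
rewrite exprSr factS natrM.
rewrite [leRHS](_ : _ = (2 * n%:R * M) ^+ k * k`!%:R * (2 * n%:R * M * k.+1%:R)).
  by rewrite ler_wpM2l// mulr_ge0// exprn_ge0// !mulr_ge0.
by ring.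
Qed.

Definition taylor_coef c n (L : {ffun 'I_n -> S} -> R) j g : R :=
  replica_mean (replica_derivn c j L) g / j`!%:R.

Section taylor_replica_mean.
Variables (c : S -> R) (n : nat) (L : {ffun 'I_n -> S} -> R) (M : R) (s0 : S).
Hypotheses (n1 : (1 <= n)%N) (L1 : forall r, `|L r| <= 1)
  (cM : forall s, `|c s| <= M).

Lemma taylor_coef_bound j E :
  `|taylor_coef c L j (boltzmann E)| <= (2 * n%:R * M) ^+ j.
Proof.
rewrite normrM normfV [X in _ / X]ger0_norm// ler_pdivrMr ?ltr0n ?fact_gt0//.
apply: replica_mean_bound => [s||r]; [exact: boltzmann_ge0| |].
  exact: boltzmann_sum1 s0.
exact: replica_derivn_bound.
Qed.

(** The factorial in the bound on the derivatives cancels the one of Taylor's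
    formula.  The estimate holds for all [u] and [K]; this uniformity is what
    allows fourth and fifth order bounds to be combined. *)
Lemma taylor_replica_mean E K (u : R) :
  `|replica_mean L (boltzmann (fun s => E s + u * c s)) -
    \sum_(j < K) taylor_coef c L j (boltzmann E) * u ^+ j|
  <= (2 * n%:R * M * `|u|) ^+ K.
Proof.
pose f k (u : R) := replica_mean (replica_derivn c k L)
  (boltzmann (fun s => E s + u * c s)).
have E0 : (fun s => E s + 0 * c s) = E.
  by apply/funext => s; rewrite mul0r addr0.
have := @taylor_bound R ((2 * n%:R * M) ^+ K * K`!%:R) K f _ _ u.
rewrite (mulrAC _ K`!%:R) mulfK -?exprMn; last by rewrite pnatr_eq0 -lt0n fact_gt0.
rewrite /f E0; apply.
- by move=> k _ v; exact: is_derive_replica_mean s0.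
- move=> v; apply: replica_mean_bound => [s||r]; [exact: boltzmann_ge0| |].
    exact: boltzmann_sum1 s0.
  exact: replica_derivn_bound.
Qed.

End taylor_replica_mean.

End boltzmann.

(** * Independence and product formulas *)

(** Independence says that the law of [(X, Z)] is the product of the two laws, so
    that Fubini's theorem applies to the function [(x, z) |-> x * z]. *)
Section independent_pair.
Context d (T : measurableType d) (R : realType) (P : probability T R).
Variables (X Z : T -> R).
Hypotheses (mX : measurable_fun [set: T] X) (mZ : measurable_fun [set: T] Z).
Hypothesis XZ_indep : forall A B : set R, measurable A -> measurable B ->
  P (X @^-1` A `&` Z @^-1` B) = (P (X @^-1` A) * P (Z @^-1` B))%E.
Hypotheses (iX : P.-integrable [set: T] (EFin \o X))
  (iZ : P.-integrable [set: T] (EFin \o Z)).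

Let X' : {mfun T >-> R} := HB.pack X (isMeasurableFun.Build _ _ _ _ _ mX).
Let Z' : {mfun T >-> R} := HB.pack Z (isMeasurableFun.Build _ _ _ _ _ mZ).
Let XZ w := (X w, Z w).
Let mXZ : measurable_fun [set: T] XZ := measurable_fun_pair mX mZ.
Let XZ' : {mfun T >-> (R * R)%type} := HB.pack XZ (isMeasurableFun.Build _ _ _ _ _ mXZ).
Let lX := distribution P X'.
Let lZ := distribution P Z'.
Let RR : measurableType _ := (R * R)%type.
Let mul (z : RR) : \bar R := (z.1 * z.2)%:E.

Let joint_law A : measurable A -> (lX \x lZ)%E A = distribution P XZ' A.
Proof.
move=> mA; apply: product_measure_unique => //= B C mB mC.
Qed.

Let mmul : measurable_fun [set: RR] mul.
Proof. by apply/measurable_EFinP; exact: measurable_funM. Qed.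

Let imul : (lX \x lZ)%E.-integrable [set: RR] mul.
Proof.
apply/integrable12ltyP => //.
under eq_integral => x _.
  under eq_integral => z _ do rewrite /mul/= normrM EFinM.
  rewrite ge0_integralZl//; last first.
    by apply/measurable_EFinP; exact: normr_measurable.
  rewrite ge0_integral_distribution//; last first.
    by apply/measurable_EFinP; exact: normr_measurable.
  over.
have /integrableP[_ Zoo] := iZ; have /integrableP[_ Xoo] := iX.
rewrite ge0_integralZr//; last first.
- by apply: integral_ge0 => w _; rewrite lee_fin.
- by apply/measurable_EFinP; exact: normr_measurable.
rewrite ge0_integral_distribution//; last first.
  by apply/measurable_EFinP; exact: normr_measurable.
rewrite lte_mul_pinfty//; first by apply: integral_ge0 => w _; rewrite lee_fin.
by rewrite ge0_fin_numE//; apply: integral_ge0 => w _; rewrite lee_fin.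
Qed.

Let ijoint : (distribution P XZ').-integrable [set: RR] mul.
Proof.
have /integrableP[_ h] := imul; apply/integrableP; split => //.
by rewrite -(eq_measure_integral _ (fun A mA _ => joint_law mA)).
Qed.

Lemma integrable_indepM : P.-integrable [set: T] (fun w => (X w * Z w)%:E).
Proof.
have /integrableP[_ h] := ijoint; apply/integrableP; split.
  by apply/measurable_EFinP; exact: measurable_funM.
move: h; rewrite ge0_integral_distribution//.
exact: measurableT_comp.
Qed.

Lemma Rintegral_indepM :
  \int[P]_w (X w * Z w) = (\int[P]_w X w) * (\int[P]_w Z w).
Proof.
have -> : (\int[P]_w (X w * Z w))%R = fine (\int[lX \x lZ]_z mul z)%E.
  rewrite (eq_measure_integral _ (fun A mA _ => joint_law mA)).
  by rewrite integral_distribution//; exact: integrable_indepM.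
rewrite -integral12_prod_meas1// /Rintegral -fineM; last 2 first.
- exact: integrable_fin_num iX.
- exact: integrable_fin_num iZ.
congr fine; rewrite /fubini_F/=.
have finZ : (\int[P]_w (Z w)%:E)%E \is a fin_num by exact: integrable_fin_num iZ.
under eq_integral => x _.
  under eq_integral => z _ do rewrite /mul/= EFinM.
  rewrite integralZl//; last exact: integrable_pushforward.
  rewrite integral_distribution// [X in (_ * X)%E](_ : _ = (\int[P]_w (Z w)%:E)%E)//.
  rewrite -(fineK finZ); over.
rewrite integralZr//; last exact: integrable_pushforward.
by rewrite integral_distribution// fineK.
Qed.

End independent_pair.

(** * Functionals of a family of random variables *)

(** Quantifying over every measurable space, instead of fixing a sigma-algebra on
    [I -> R], allows the sigma-algebra of the source to be replaced by the smaller
    one that a subfamily generates. *)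
Definition measurable_functional (R : realType) (I : Type)
    (F : (I -> R) -> R) : Prop :=
  forall d (T : measurableType d) (Z : I -> T -> R),
    (forall i, measurable_fun [set: T] (Z i)) ->
    measurable_fun [set: T] (fun w => F (Z ^~ w)).

(** The reals off [J] are set to zero rather than dropped, so that a functional of
    the whole family can be evaluated on a subfamily. *)
Definition restrict_family (R : realType) (I : choiceType) (J : {fset I})
  (x : I -> R) (i : I) : R := if i \in J then x i else 0.

Section independent_functional.
Context d (T : measurableType d) (R : realType) (P : probability T R).
Variables (I : choiceType) (D : set I) (Z : I -> {RV P >-> R}).
Hypothesis Z_indep : mutually_independent D Z.

(** The events [\bigcap_(i in J) Z i @^-1` U i] form a pi-system that generates
    the sigma-algebra for which the restricted family is measurable.  On it the
    finite measures [C |-> P (C `&` Z i0 @^-1` B)] and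
    [C |-> P C * P (Z i0 @^-1` B)] agree by independence, hence they agree on the
    sigma-algebra. *)
Lemma mutually_independent_functional (J : {fset I}) (i0 : I)
    (F : (I -> R) -> R) :
  [set` J] `<=` D -> D i0 -> i0 \notin J -> measurable_functional F ->
  forall A B : set R, measurable A -> measurable B ->
  let X w := F (restrict_family J (Z ^~ w)) in
  P (X @^-1` A `&` Z i0 @^-1` B) = (P (X @^-1` A) * P (Z i0 @^-1` B))%E.
Proof.
move=> JD Di0 i0J mF A B mA mB X.
pose G : set (set T) := [set C | exists2 U : I -> set R,
  forall i, measurable (U i) & C = \bigcap_(i in [set` J]) (Z i @^-1` U i)].
have mZ i (U : set R) : measurable U -> measurable (Z i @^-1` U).
  by move=> mU; rewrite -[_ @^-1` _]setTI; exact: measurable_funP.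
(* [X] is measurable for the sigma-algebra generated by the family [Z i], [i]
   in [J]: this instantiates [mF] on the same set with fewer measurable sets. *)
have XA : <<s G >> (X @^-1` A).
  have : measurable_fun [set: g_sigma_algebraType G] X.
    apply: (mF _ (g_sigma_algebraType G)
      (fun i w => if i \in J then Z i w else 0)) => i.
    have [iJ|_] := boolP (i \in J); last exact: measurable_cst.
    move=> _ U mU; rewrite setTI; apply: sub_sigma_algebra.
    exists (fun j => if j == i then U else setT).
      by move=> j; case: ifP.
    apply/seteqP; split=> [w Uw j _|w /(_ i iJ)]; last by rewrite eqxx.
    by case: eqP => // ->.
  by move=> /(_ measurableT _ mA); rewrite setTI.
have mV := mZ i0 _ mB.
have V0 : 0 <= fine (P (Z i0 @^-1` B)) by rewrite fine_ge0.
have m2E C : mscale (NngNum V0) P C = (P C * P (Z i0 @^-1` B))%E.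
  rewrite /mscale muleC; congr (_ * _)%E.
  by transitivity (fine (P (Z i0 @^-1` B)))%:E; rewrite ?fineK ?fin_num_measure//.
rewrite -m2E; apply: (@g_sigma_algebra_measure_unique _ _ _ G _ (fun=> setT) _ _
  (mrestr P mV) (mscale (NngNum V0) P) _ _ _ _ XA).
- move=> _ [U mU ->]; apply: fin_bigcap_measurable => // i _; exact: mZ.
- by move=> _; exists (fun=> setT) => //; apply/seteqP; split.
- by apply/seteqP; split => // w _; exists 0%N.
- move=> _ _ [U mU ->] [U' mU' ->]; exists (fun i => U i `&` U' i).
    by move=> i; exact: measurableI.
  by rewrite -bigcapI.
- move=> _ [U mU ->]; rewrite [RHS]m2E /= /mrestr.
  pose U' i := if i == i0 then B else U i.
  have mU' i : measurable (U' i) by rewrite /U'; case: ifP.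
  have UU' i : i \in J -> U' i = U i.
    by rewrite /U'; case: eqP => // -> i0J'; rewrite i0J' in i0J.
  have -> : \bigcap_(i in [set` J]) (Z i @^-1` U i) `&` Z i0 @^-1` B =
      \bigcap_(i in [set` (i0 |` J)%fset]) (Z i @^-1` U' i).
    apply/seteqP; split => [w [Uw Bw] i /=|w Uw].
      rewrite !inE => /predU1P[->|iJ]; first by rewrite /U' eqxx.
      by rewrite UU'//; exact: Uw.
    split; last by have := Uw i0; rewrite /= fset1U1 /U' eqxx; apply.
    by move=> i iJ; have := Uw i; rewrite /= UU'//; apply; rewrite fset1Ur.
  rewrite !Z_indep//; last first.
    by move=> i /=; rewrite !inE => /predU1P[->//|]; exact: JD.
  rewrite big_fsetU1//= /U' eqxx muleC; congr (_ * _)%E.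
  by apply: eq_big_seq => i iJ; rewrite -/(U' i) UU'.
- by move=> _; rewrite /= /mrestr setTI (le_lt_trans (probability_le1 _ _))// ltry.
Qed.

End independent_functional.

(** * Integrals of functions of one random variable *)

Section law.
Context d (T : measurableType d) (R : realType) (P : probability T R).
Variables (Z : {RV P >-> R}) (lam : probability R R).
Hypothesis Z_law : forall B, measurable B -> distribution P Z B = lam B.

Lemma integrable_law (f : R -> R) :
  lam.-integrable [set: R] (EFin \o f) ->
  P.-integrable [set: T] (fun w => (f (Z w))%:E).
Proof.
move=> /integrableP[mf f_oo].
apply/integrableP; split.
  exact: (measurableT_comp mf).
move: f_oo; rewrite -(eq_measure_integral _ (fun B mB _ => Z_law mB)).
by rewrite ge0_integral_distribution//; exact: measurableT_comp.
Qed.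

Lemma Rintegral_law (f : R -> R) :
  lam.-integrable [set: R] (EFin \o f) ->
  \int[P]_w f (Z w) = \int[lam]_u f u.
Proof.
move=> fi; rewrite /Rintegral.
rewrite -(eq_measure_integral _ (fun B mB _ => Z_law mB)).
rewrite integral_distribution//; last exact: integrable_law.
by case/integrableP: fi.
Qed.

End law.

Section bounded.
Context d (T : measurableType d) (R : realType) (P : probability T R).

Lemma bounded_integrable (f : T -> R) (B : R) : measurable_fun [set: T] f ->
  (forall w, `|f w| <= B) -> P.-integrable [set: T] (EFin \o f).
Proof.
move=> mf fB; apply: measurable_bounded_integrable => //.
  by rewrite -ge0_fin_numE// fin_num_measure.
exists B; split; first exact: num_real.
by move=> x Bx w _ /=; exact: le_trans (fB w) (ltW Bx).
Qed.

Lemma integrableMbounded (f g : T -> R) (B : R) : measurable_fun [set: T] f ->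
  (forall w, `|f w| <= B) -> P.-integrable [set: T] (EFin \o g) ->
  P.-integrable [set: T] (fun w => (f w * g w)%:E).
Proof.
move=> mf fB gi; have /integrableP[/measurable_EFinP mg _] := gi.
apply: (le_integrable measurableT _ _
  (integrableZl measurableT B (integrable_norm gi))).
  by apply/measurable_EFinP; exact: measurable_funM.
move=> w _ /=; rewrite lee_fin normrM [leRHS]normrM normr_id ler_wpM2r//.
exact: le_trans (fB w) (ler_norm _).
Qed.

End bounded.

Lemma integrable_sumR d (T : measurableType d) (R : realType) (P : probability T R)
    (I : Type) (s : seq I) (f : I -> T -> R) :
  (forall i, P.-integrable [set: T] (EFin \o f i)) ->
  P.-integrable [set: T] (EFin \o (fun w => \sum_(i <- s) f i w)).
Proof.
move=> fi; rewrite (_ : _ \o _ = (fun w => \sum_(i <- s) (EFin \o f i) w)%E).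
  exact: integrable_sum.
by apply/funext => w /=; rewrite -sumEFin.
Qed.

Lemma Rintegral_sum d (T : measurableType d) (R : realType) (P : probability T R)
    (I : Type) (s : seq I) (f : I -> T -> R) :
  (forall i, P.-integrable [set: T] (EFin \o f i)) ->
  \int[P]_w (\sum_(i <- s) f i w) = \sum_(i <- s) \int[P]_w f i w.
Proof.
move=> fi; rewrite /Rintegral; under eq_integral do rewrite -sumEFin.
rewrite integral_sum// sum_fine// => i _.
exact: integrable_fin_num (fi i).
Qed.

Lemma Rintegral_constant d (T : measurableType d) (R : realType)
  (P : probability T R) (r : R) : \int[P]_w r = r.
Proof.
rewrite Rintegral_cst// -[RHS]mulr1; congr (_ * _); rewrite -[RHS]/(fine 1%E).
by congr fine; exact: probability_setT.
Qed.

(** [|u|^j <= 1 + |u|^K]. *)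
Lemma integrable_lower_moment (R : realType) (lam : probability R R) j K :
  (j <= K)%N -> lam.-integrable [set: R] (fun u => (u ^+ K)%:E) ->
  lam.-integrable [set: R] (fun u => (u ^+ j)%:E).
Proof.
move=> jK iK.
have := integrableD measurableT
  (finite_measure_integrable_cst lam 1 measurableT) (integrable_norm iK).
apply: le_integrable => //; first exact/measurable_EFinP.
move=> u _ /=; rewrite lee_fin !normrX [leRHS]ger0_norm ?addr_ge0 ?exprn_ge0//.
have [u1|u1] := leP `|u| 1.
  by apply: (@le_trans _ _ 1); rewrite ?exprn_ile1// lerDl exprn_ge0.
by apply: (le_trans (ler_weXn2l (ltW u1) jK)); rewrite lerDr.
Qed.

Lemma integrable_tail (R : realType) (mu : probability R R) (theta : R) (f : R -> R) :
  mu.-integrable [set: R] (EFin \o f) ->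
  mu.-integrable [set: R]
    (EFin \o (fun u => f u * \1_[set v | theta <= `|v|] u)).
Proof.
move=> fi; set tail := mkset _.
have mtail : measurable tail.
  rewrite (_ : tail = (fun v : R => `|v|) @^-1` `[theta, +oo[%classic).
    by rewrite -[_ @^-1` _]setTI; exact: (normr_measurable measurableT).
  by apply/seteqP; split=> v /=; rewrite in_itv/= andbT.
have mind : measurable_fun [set: R] (\1_tail : R -> R) by exact: measurable_indic.
have h : mu.-integrable [set: R] (fun u => (\1_tail u * f u)%:E).
  apply: (integrableMbounded (B := 1)) => // u.
  by rewrite indicE; case: (_ \in _); rewrite ?normr1 ?normr0.
by apply: eq_integrable h => // u _ /=; rewrite mulrC.
Qed.

Lemma integrable_abs_moment (R : realType) (lam : probability R R) k :
  lam.-integrable [set: R] (fun u => (u ^+ k)%:E) ->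
  lam.-integrable [set: R] (EFin \o (fun u => `|u| ^+ k)).
Proof.
move=> ik; have := integrable_norm ik.
by apply: eq_integrable => // u _ /=; rewrite normrX.
Qed.

(** The inequality of arithmetic and geometric means: it bounds odd absolute
    moments by even moments, which are the computable ones. *)
Lemma abs_moment_le (R : realType) (lam : probability R R) a b :
  lam.-integrable [set: R] (fun u => (u ^+ (2 * a))%:E) ->
  lam.-integrable [set: R] (fun u => (u ^+ (2 * b))%:E) ->
  \int[lam]_u (`|u| ^+ (a + b)) <=
  (\int[lam]_u (u ^+ (2 * a)) + \int[lam]_u (u ^+ (2 * b))) / 2.
Proof.
move=> ia ib.
have iD : lam.-integrable [set: R]
    (EFin \o (fun u => u ^+ (2 * a) + u ^+ (2 * b))).
  by have := integrableD measurableT ia ib; apply: eq_integrable.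
have sqE (u : R) k : u ^+ (2 * k) = (`|u| ^+ k) ^+ 2.
  by rewrite exprM -(real_normK (num_real u)) -exprM mulnC exprM.
have amgm (u : R) : `|u| ^+ (a + b) <= 2^-1 * (u ^+ (2 * a) + u ^+ (2 * b)).
  rewrite !sqE exprD; have := sqr_ge0 (`|u| ^+ a - `|u| ^+ b).
  rewrite sqrrB; lra.
have iH := integrableZl measurableT 2^-1 iD.
rewrite -RintegralD// mulrC -RintegralZl//.
apply: le_Rintegral => //.
apply: le_integrable iH => //; first exact/measurable_EFinP/measurable_funX.
move=> u _ /=; rewrite lee_fin ger0_norm ?exprn_ge0//.
exact: le_trans (amgm u) (ler_norm _).
Qed.

(** * Replacing one variable at a time *)

(** The function [F] of the family is approximated by a polynomial in the variable
    [Z i0], whose coefficients only see the subfamily [J].  Independence separates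
    each coefficient from the power that it multiplies. *)
Section expectation_expansion.
Context d (T : measurableType d) (R : realType) (P : probability T R).
Variables (I : choiceType) (D : set I) (Z : I -> {RV P >-> R}).
Hypothesis Z_indep : mutually_independent D Z.
Variables (i0 : I) (J : {fset I}) (lam : probability R R).
Hypotheses (JD : [set` J] `<=` D) (Di0 : D i0) (i0J : i0 \notin J)
  (Z_law : forall B, measurable B -> distribution P (Z i0) B = lam B).
Variables (F : (I -> R) -> R) (K : nat) (a : nat -> (I -> R) -> R)
  (A : nat -> R) (B : R) (rho : R -> R).
Hypotheses (mF : measurable_functional F) (F_bd : forall x, `|F x| <= B)
  (ma : forall j, measurable_functional (a j))
  (a_bd : forall j x, `|a j x| <= A j)
  (F_exp : forall x, `|F x - \sum_(j < K) a j (restrict_family J x) * x i0 ^+ j|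
     <= rho (x i0))
  (lam_moment : forall j, (j < K)%N ->
     lam.-integrable [set: R] (fun u => (u ^+ j)%:E))
  (rho_int : lam.-integrable [set: R] (EFin \o rho)).

Let mZ i : measurable_fun [set: T] (Z i).
Proof. exact: measurable_funP. Qed.

Lemma expectation_expansion :
  `|\int[P]_w F (Z ^~ w) -
    \sum_(j < K) (\int[P]_w a j (restrict_family J (Z ^~ w))) *
      (\int[lam]_u u ^+ j)| <= \int[lam]_u rho u.
Proof.
pose X j w := a j (restrict_family J (Z ^~ w)).
have mX j : measurable_fun [set: T] (X j).
  apply: (ma j (Z := fun i w => if i \in J then Z i w else 0)) => i.
  by have [iJ|_] := boolP (i \in J); [exact: mZ|exact: measurable_cst].
have mFZ : measurable_fun [set: T] (fun w => F (Z ^~ w)) by exact: mF.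
have iFZ := bounded_integrable P mFZ (fun w => F_bd (Z ^~ w)).
have iZj (j : 'I_K) := integrable_law Z_law (lam_moment (ltn_ord j)).
have iXZ (j : 'I_K) : P.-integrable [set: T] (fun w => (X j w * Z i0 w ^+ j)%:E).
  exact: (integrableMbounded (mX j) (fun w => a_bd j _) (iZj j)).
have prodE (j : 'I_K) : \int[P]_w (X j w * Z i0 w ^+ j) =
    (\int[P]_w X j w) * (\int[lam]_u u ^+ j).
  rewrite -(Rintegral_law Z_law (lam_moment (ltn_ord j))).
  apply: Rintegral_indepM => //.
  - by apply: measurable_funX; exact: mZ.
  - move=> U V mU mV.
    have mV' : measurable ((fun u : R => u ^+ j) @^-1` V).
      by rewrite -[_ @^-1` _]setTI; exact: (exprn_measurable _ measurableT).
    exact: (mutually_independent_functional Z_indep JD Di0 i0J (ma j) mU mV').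
  - exact: (bounded_integrable P (mX j) (fun w => a_bd j _)).
  - exact: iZj.
rewrite -(eq_bigr _ (fun j _ => prodE j)).
have iS : P.-integrable [set: T]
    (EFin \o (fun w => \sum_(j < K) X j w * Z i0 w ^+ j)).
  exact: integrable_sumR.
rewrite -Rintegral_sum// -RintegralB//.
have iD : P.-integrable [set: T]
    (EFin \o (fun w => F (Z ^~ w) - \sum_(j < K) X j w * Z i0 w ^+ j)).
  by apply: (eq_integrable measurableT _ _ _ (integrableB measurableT iFZ iS)).
rewrite (le_trans (le_normr_Rintegral _ _))//.
rewrite -(Rintegral_law Z_law rho_int); apply: le_Rintegral => //.
- exact: integrable_norm.
- exact: (integrable_law Z_law rho_int).
Qed.

End expectation_expansion.

Section product_probability.
Context d d' (T : measurableType d) (T' : measurableType d') (R : realType).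
Variables (P : probability T R) (P' : probability T' R).

Definition product_probability : set (T * T') -> \bar R := (P \x P')%E.

HB.instance Definition _ := Measure.on product_probability.

Let product_probability_setT : product_probability setT = 1%E.
Proof.
rewrite /product_probability -setXTT product_measure1E//.
by rewrite -[RHS]mule1; congr (_ * _)%E; exact: probability_setT.
Qed.

HB.instance Definition _ := Measure_isProbability.Build _ _ _
  product_probability product_probability_setT.

Lemma product_probabilityE A B : measurable A -> measurable B ->
  product_probability (A `*` B) = (P A * P' B)%E.
Proof. exact: product_measure1E. Qed.

End product_probability.

(** The two disorders are defined on unrelated probability spaces.  On the product
    space they become independent of each other, and [mixed b] takes the members
    selected by [b] from the first one and the rest from the second. *)
Section mixed_family.
Context d d' (T : measurableType d) (T' : measurableType d') (R : realType).
Variables (P : probability T R) (P' : probability T' R) (I : choiceType).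
Variables (Y : I -> {RV P >-> R}) (G : I -> {RV P' >-> R}).
Let PP : probability (T * T')%type R := product_probability P P'.

Definition mixed (b : pred I) (i : I) (w : T * T') : R :=
  if b i then Y i w.1 else G i w.2.

Lemma measurable_mixed b i : measurable_fun [set: T * T'] (mixed b i).
Proof.
rewrite /mixed; case: (b i).
  exact: (measurableT_comp (measurable_funPT (Y i)) measurable_fst).
exact: (measurableT_comp (measurable_funPT (G i)) measurable_snd).
Qed.

HB.instance Definition _ b i :=
  isMeasurableFun.Build _ _ _ _ (mixed b i) (measurable_mixed b i).

Definition mixed_RV b i : {RV PP >-> R} := mixed b i.

Lemma mixed_law b i B : measurable B ->
  distribution PP (mixed_RV b i) B =
  if b i then distribution P (Y i) B else distribution P' (G i) B.
Proof.
move=> mB; have mY := measurable_funPTI (Y i) mB.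
have mG := measurable_funPTI (G i) mB.
have mixedE : mixed_RV b i @^-1` B =
    if b i then (Y i @^-1` B) `*` setT else setT `*` (G i @^-1` B).
  apply/seteqP; rewrite /mixed_RV/= /mixed.
  by case: (b i); split => -[w w']//= [].
rewrite /distribution /pushforward mixedE; case: (b i).
  rewrite [LHS](product_probabilityE P P' mY measurableT).
  by rewrite probability_setT mule1.
rewrite [LHS](product_probabilityE P P' measurableT mG).
by rewrite probability_setT mul1e.
Qed.

(** An intersection of events of the mixed family is a rectangle, with one side for
    each space. *)
Lemma mixed_independent (D : set I) b :
  mutually_independent D Y -> mutually_independent D G ->
  mutually_independent D (mixed_RV b).
Proof.
move=> Y_indep G_indep J B JD mB.
have mY i := measurable_funPTI (Y i) (mB i).
have mG i := measurable_funPTI (G i) (mB i).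
pose JY := [fset i in J | b i]%fset; pose JG := [fset i in J | ~~ b i]%fset.
have -> : \bigcap_(i in [set` J]) (mixed_RV b i @^-1` B i) =
    (\bigcap_(i in [set` JY]) (Y i @^-1` B i)) `*`
    (\bigcap_(i in [set` JG]) (G i @^-1` B i)).
  apply/seteqP; split => [[w w'] /= h|[w w'] /= [hY hG] i /= iJ].
    split=> i /=; rewrite !inE => /andP[iJ bi]; have := h i iJ.
      by rewrite /mixed_RV/= /mixed bi.
    by rewrite /mixed_RV/= /mixed (negbTE bi).
  rewrite /mixed_RV/= /mixed; case: ifPn => bi.
    by apply: hY; rewrite /= !inE; apply/andP.
  by apply: hG; rewrite /= !inE; apply/andP.
rewrite [LHS]product_probabilityE; last 2 first.
- by apply: fin_bigcap_measurable => // i _; exact: mY.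
- by apply: fin_bigcap_measurable => // i _; exact: mG.
rewrite Y_indep//; last by move=> i /=; rewrite !inE => /andP[/JD].
rewrite G_indep//; last by move=> i /=; rewrite !inE => /andP[/JD].
rewrite [RHS](bigID b)/= -!big_fset_condE/=; congr (_ * _)%E.
  apply: eq_bigr => i bi.
  by have := mixed_law b i (mB i); rewrite bi => h; exact: esym h.
apply: eq_bigr => i bi.
by have := mixed_law b i (mB i); rewrite (negbTE bi) => h; exact: esym h.
Qed.

End mixed_family.

Section product_marginals.
Context d d' (T : measurableType d) (T' : measurableType d') (R : realType).
Variables (P : probability T R) (P' : probability T' R).
Let PP : probability (T * T')%type R := product_probability P P'.

Lemma Rintegral_fst (f : T -> R) (B : R) : measurable_fun [set: T] f ->
  (forall w, `|f w| <= B) -> \int[PP]_w f w.1 = \int[P]_w f w.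
Proof.
move=> mf fB; have mf1 : measurable_fun [set: T * T'] (fun w => f w.1).
  exact: (measurableT_comp mf measurable_fst).
rewrite /Rintegral; congr fine.
have fstE A : measurable A -> A `<=` setT -> pushforward PP fst A = P A.
  move=> mA _; rewrite /pushforward.
  have -> : @fst T T' @^-1` A = A `*` setT by apply/seteqP; split => -[w w']//= [].
  rewrite [LHS](product_probabilityE P P' mA measurableT).
  by rewrite probability_setT mule1.
rewrite -(eq_measure_integral _ fstE) integral_pushforward//.
  exact/measurable_EFinP.
exact: (bounded_integrable PP mf1 (fun w => fB w.1)).
Qed.

Lemma Rintegral_snd (f : T' -> R) (B : R) : measurable_fun [set: T'] f ->
  (forall w, `|f w| <= B) -> \int[PP]_w f w.2 = \int[P']_w f w.
Proof.
move=> mf fB; have mf2 : measurable_fun [set: T * T'] (fun w => f w.2).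
  exact: (measurableT_comp mf measurable_snd).
rewrite /Rintegral; congr fine.
have sndE A : measurable A -> A `<=` setT -> pushforward PP snd A = P' A.
  move=> mA _; rewrite /pushforward.
  have -> : @snd T T' @^-1` A = setT `*` A by apply/seteqP; split => -[w w']//= [].
  rewrite [LHS](product_probabilityE P P' measurableT mA).
  by rewrite probability_setT mul1e.
rewrite -(eq_measure_integral _ sndE) integral_pushforward//.
  exact/measurable_EFinP.
exact: (bounded_integrable PP mf2 (fun w => fB w.2)).
Qed.

End product_marginals.

(** [rho i] bounds the remainder of the expansion of [F] in the [i]-th variable,
    and [a i j] is its coefficient of degree [j]. *)
Section lindeberg.
Context d d' (T : measurableType d) (T' : measurableType d') (R : realType).
Variables (P : probability T R) (P' : probability T' R) (I : choiceType).
Variables (D : set I) (Y : I -> {RV P >-> R}) (G : I -> {RV P' >-> R}).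
Variables (mu nu : probability R R).
Hypotheses (Y_indep : mutually_independent D Y)
  (G_indep : mutually_independent D G)
  (Y_law : forall i, D i -> forall B, measurable B -> distribution P (Y i) B = mu B)
  (G_law : forall i, D i -> forall B, measurable B -> distribution P' (G i) B = nu B).
Variables (K : nat) (sites : seq I) (F : (I -> R) -> R) (B : R)
  (a : I -> nat -> (I -> R) -> R) (A : I -> nat -> R) (rho : I -> R -> R).
Hypotheses (mu_moment : forall j, (j < K)%N ->
    mu.-integrable [set: R] (fun u => (u ^+ j)%:E))
  (nu_moment : forall j, (j < K)%N ->
    nu.-integrable [set: R] (fun u => (u ^+ j)%:E))
  (moment_match : forall j, (j < K)%N ->
    \int[mu]_u (u ^+ j) = \int[nu]_u (u ^+ j)).
Hypotheses (sites_uniq : uniq sites) (sitesD : forall i, i \in sites -> D i).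
Hypotheses (mF : measurable_functional F) (F_bd : forall x, `|F x| <= B)
  (F_dep : forall x x', {in sites, x =1 x'} -> F x = F x').
Hypotheses (ma : forall i j, measurable_functional (a i j))
  (a_bd : forall i j x, `|a i j x| <= A i j)
  (mu_rho : forall i, mu.-integrable [set: R] (EFin \o rho i))
  (nu_rho : forall i, nu.-integrable [set: R] (EFin \o rho i)).

Let others i : {fset I} := [fset k in sites | k != i]%fset.

Hypothesis F_exp : forall i, i \in sites -> forall x,
  `|F x - \sum_(j < K) a i j (restrict_family (others i) x) * x i ^+ j|
  <= rho i (x i).

Let PP : probability (T * T')%type R := product_probability P P'.
Let mean (b : pred I) := \int[PP]_w F (mixed Y G b ^~ w).

(* The main terms of the two expansions coincide: their coefficients only see the
   variables other than the [i]-th, which [b] and [b'] draw from the same side,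
   and the moments that multiply them are equal. *)
Let swap (b b' : pred I) i : i \in sites -> b i = false -> b' i = true ->
  (forall k, k != i -> b k = b' k) ->
  `|mean b - mean b'| <= \int[mu]_u rho i u + \int[nu]_u rho i u.
Proof.
move=> isites bi b'i bb'.
have oD : [set` others i] `<=` D.
  by move=> k /=; rewrite !inE => /andP[/sitesD].
have oi : i \notin others i by rewrite !inE eqxx andbF.
have lawb C : measurable C -> distribution PP (mixed_RV Y G b i) C = nu C.
  by move=> mC; rewrite mixed_law// bi; apply: G_law => //; exact: sitesD.
have lawb' C : measurable C -> distribution PP (mixed_RV Y G b' i) C = mu C.
  by move=> mC; rewrite mixed_law// b'i; apply: Y_law => //; exact: sitesD.
have := expectation_expansion (mixed_independent b Y_indep G_indep)
  oD (sitesD isites) oi lawb mF F_bd (ma i) (a_bd i)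
  (F_exp isites) nu_moment (nu_rho i).
have := expectation_expansion (mixed_independent b' Y_indep G_indep)
  oD (sitesD isites) oi lawb' mF F_bd (ma i) (a_bd i)
  (F_exp isites) mu_moment (mu_rho i).
set S' := \sum_(j < K) _; set S := \sum_(j < K) _.
have -> : S = S'.
  apply: eq_bigr => j _; rewrite (moment_match (ltn_ord j)); congr (_ * _).
  apply: eq_Rintegral => w _; congr (a i j _); apply/funext => k.
  rewrite /restrict_family; case: ifPn => //; rewrite !inE => /andP[_ ki].
  by rewrite /mixed_RV/= /mixed (bb' _ ki).
rewrite -/(mean b) -/(mean b') => h' h.
rewrite (_ : mean b - mean b' = (mean b - S') - (mean b' - S')); last by ring.
by rewrite (le_trans (ler_normB _ _))// addrC lerD.
Qed.

Let swaps (s : seq I) : uniq s -> {subset s <= sites} ->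
  `|mean pred0 - mean (mem s)| <=
  \sum_(i <- s) (\int[mu]_u rho i u + \int[nu]_u rho i u).
Proof.
elim: s => [|i s IH] /=.
  by move=> _ _; rewrite big_nil [mean (mem [::])](_ : _ = mean pred0) ?subrr ?normr0.
move=> /andP[is_ us] ss; rewrite big_cons.
rewrite (_ : _ - _ = (mean (mem s) - mean (mem (i :: s))) +
  (mean pred0 - mean (mem s))); last by ring.
rewrite (le_trans (ler_normD _ _))// lerD//.
  apply: swap; [by apply: ss; rewrite mem_head|exact: negbTE|exact: mem_head|].
  by move=> k /negbTE ki; rewrite /= inE ki.
by apply: IH => // k ks; apply: ss; rewrite inE ks orbT.
Qed.

Theorem lindeberg :
  `|\int[P']_w F (G ^~ w) - \int[P]_w F (Y ^~ w)| <=
  \sum_(i <- sites) (\int[mu]_u rho i u + \int[nu]_u rho i u).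
Proof.
have mFY : measurable_fun [set: T] (fun w => F (Y ^~ w)).
  by apply: mF => i; exact: measurable_funP.
have mFG : measurable_fun [set: T'] (fun w => F (G ^~ w)).
  by apply: mF => i; exact: measurable_funP.
have <- : mean pred0 = \int[P']_w F (G ^~ w).
  exact: (Rintegral_snd P P' mFG (fun w => F_bd (G ^~ w))).
have <- : mean (mem sites) = \int[P]_w F (Y ^~ w).
  rewrite -(Rintegral_fst P P' mFY (fun w => F_bd (Y ^~ w))).
  apply: eq_Rintegral => w _; apply: F_dep => i isites.
  by rewrite /mixed /= isites.
exact: swaps.
Qed.

End lindeberg.

(** * The replacement bound for Gibbs averages *)

(** The quotient in a Boltzmann weight is written as [expR (E s - ln Z)], where [Z]
    is the partition function, to be a composition of measurable functions. *)
Lemma measurable_functional_replica_mean (R : realType) (I : Type) (S : finType)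
    n (L : {ffun 'I_n -> S} -> R) (E : (I -> R) -> S -> R) :
  (forall s, measurable_functional (E ^~ s)) ->
  measurable_functional (fun x => replica_mean L (boltzmann (E x))).
Proof.
move=> mE d T Z mZ; apply: measurable_sum => r.
apply: measurable_funM => //; apply: measurable_prod => l _.
have -> : (fun w => boltzmann (E (Z ^~ w)) (r l)) = (fun w =>
    expR (E (Z ^~ w) (r l) - ln (\sum_s expR (E (Z ^~ w) s)))).
  apply/funext => w; rewrite expRD expRN lnK// posrE.
  exact: partition_gt0 (r l).
apply: measurableT_comp; first exact: measurable_expR.
apply: measurable_funB; first exact: mE.
apply: measurableT_comp; first exact: measurable_ln.
apply: measurable_sum => s; apply: measurableT_comp; first exact: measurable_expR.
exact: mE.
Qed.

Section linear_energy.
Variables (R : realType) (I : choiceType) (S : finType) (sites : seq I).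
Variables (h : S -> R) (k : I -> S -> R).

Definition energy (x : I -> R) (s : S) : R := h s + \sum_(i <- sites) x i * k i s.

Lemma measurable_functional_energy s : measurable_functional (energy ^~ s).
Proof.
move=> d T Z mZ; apply: measurable_funD => //.
by apply: measurable_sum => i; apply: measurable_funM.
Qed.

(** The restricted family vanishes at [i], so its energy is the part of the energy
    that does not see the [i]-th variable. *)
Lemma energy_split i x s : uniq sites -> i \in sites ->
  energy x s =
  energy (restrict_family [fset j in sites | j != i]%fset x) s + x i * k i s.
Proof.
move=> us isites; rewrite /energy -addrA; congr (_ + _).
rewrite !(bigD1_seq i isites us)/= {1}/restrict_family !inE eqxx andbF mul0r add0r.
rewrite addrC; congr (_ + _); rewrite big_seq_cond [RHS]big_seq_cond.
by apply: eq_bigr => j /andP[js ji]; rewrite /restrict_family !inE js ji.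
Qed.

End linear_energy.

(** Bounds for the remainder after the term of degree [K].  The first is the Taylor
    estimate itself.  The second also bounds the term of degree [K] by its absolute
    value, and needs no moment beyond the [K]-th. *)
Definition remainder_bound (R : realType) (K : nat) (v : R) : R :=
  Num.min (`|v| ^+ K.+1) (2 * `|v| ^+ K).

Section gibbs_lindeberg.
Context d d' (T : measurableType d) (T' : measurableType d') (R : realType).
Variables (P : probability T R) (P' : probability T' R) (I : choiceType).
Variables (D : set I) (Y : I -> {RV P >-> R}) (G : I -> {RV P' >-> R}).
Variables (mu nu : probability R R).
Hypotheses (Y_indep : mutually_independent D Y)
  (G_indep : mutually_independent D G)
  (Y_law : forall i, D i -> forall B, measurable B -> distribution P (Y i) B = mu B)
  (G_law : forall i, D i -> forall B, measurable B -> distribution P' (G i) B = nu B).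
Variables (S : finType) (s0 : S) (n : nat) (L : {ffun 'I_n -> S} -> R) (K : nat)
  (sites : seq I) (h : S -> R) (k : I -> S -> R) (kap : I -> R).
Hypotheses (n_gt0 : (1 <= n)%N) (L_le1 : forall r, `|L r| <= 1)
  (sites_uniq : uniq sites) (sitesD : forall i, i \in sites -> D i)
  (k_le : forall i s, `|k i s| <= kap i).
Hypotheses (mu_moment : forall j, (j <= K)%N ->
    mu.-integrable [set: R] (fun u => (u ^+ j)%:E))
  (nu_moment : forall j, (j <= K)%N ->
    nu.-integrable [set: R] (fun u => (u ^+ j)%:E))
  (moment_match : forall j, (j <= K)%N ->
    \int[mu]_u (u ^+ j) = \int[nu]_u (u ^+ j)).

Let F (x : I -> R) := replica_mean L (boltzmann (energy sites h k x)).
Let rho i (u : R) := remainder_bound K (2 * n%:R * kap i * u).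

Let measurable_rho i : measurable_fun [set: R] (rho i).
Proof.
have mv j : measurable_fun [set: R] (fun u : R => `|2 * n%:R * kap i * u| ^+ j).
  apply: measurable_funX; apply: measurableT_comp; first exact: normr_measurable.
  exact: measurable_funM.
by apply: measurable_minr => //; exact: measurable_funM.
Qed.

Lemma integrable_remainder_bound (lam : probability R R) i :
  lam.-integrable [set: R] (fun u => (u ^+ K)%:E) ->
  lam.-integrable [set: R] (EFin \o rho i).
Proof.
move=> lamK; pose c := 2 * `|2 * n%:R * kap i| ^+ K.
have := integrableZl measurableT c (integrable_norm lamK).
apply: le_integrable => //; first exact/measurable_EFinP.
move=> u _ /=; rewrite lee_fin.
have r0 : 0 <= rho i u.
  by rewrite /rho /remainder_bound le_min exprn_ge0// mulr_ge0// exprn_ge0.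
rewrite ger0_norm// ger0_norm; last first.
  by rewrite mulr_ge0// mulr_ge0// exprn_ge0.
by rewrite ge_min; apply/orP; right; rewrite normrM exprMn normrX mulrA.
Qed.

(** A Gibbs average with linear energy satisfies the hypotheses of [lindeberg]
    by [taylor_replica_mean]. *)
Theorem gibbs_lindeberg :
  `|\int[P']_w F (G ^~ w) - \int[P]_w F (Y ^~ w)| <=
  \sum_(i <- sites) (\int[mu]_u rho i u + \int[nu]_u rho i u).
Proof.
pose a i j x := taylor_coef (k i) L j (boltzmann (energy sites h k x)).
apply: (@lindeberg _ _ _ _ _ _ _ _ D _ _ _ _ _ _ _ _ K.+1 _ F 1 a
  (fun i j => (2 * n%:R * kap i) ^+ j)) => //.
- apply: measurable_functional_replica_mean => s.
  exact: measurable_functional_energy.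
- move=> x; apply: replica_mean_bound => // [s|]; first exact: boltzmann_ge0.
  exact: boltzmann_sum1 s0.
- move=> x x' xx'; rewrite /F; congr (replica_mean _ (boltzmann _)).
  apply/funext => s; congr (_ + _); apply: eq_big_seq => i isites.
  by rewrite xx'.
- move=> i j d1 T1 Z mZ; apply: measurable_funM => //.
  apply: measurable_functional_replica_mean mZ => s.
  exact: measurable_functional_energy.
- by move=> i j x; exact: taylor_coef_bound.
- by move=> i; apply: integrable_remainder_bound; exact: mu_moment.
- by move=> i; apply: integrable_remainder_bound; exact: nu_moment.
- move=> i isites x; rewrite /rho /remainder_bound le_min; apply/andP.
  set x' := restrict_family _ x.
  have -> : F x = replica_mean L (boltzmann (fun s =>
      energy sites h k x' s + x i * k i s)).
    rewrite /F; congr (replica_mean _ (boltzmann _)).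
    by apply/funext => s; exact: energy_split.
  have kap0 : 0 <= kap i := le_trans (normr_ge0 _) (k_le i s0).
  have c0 : 0 <= 2 * n%:R * kap i by rewrite !mulr_ge0.
  have taylor J := taylor_replica_mean s0 n_gt0 L_le1 (k_le i)
    (energy sites h k x') J (x i).
  rewrite normrM (ger0_norm c0); split; first exact: taylor.
  (* The estimate of order [K], plus the last term of the Taylor polynomial. *)
  rewrite big_ord_recr/= opprD addrA (le_trans (ler_normB _ _))//.
  rewrite mulrDl !mul1r lerD//; first exact: taylor.
  rewrite normrM normrX exprMn ler_wpM2r// ?exprn_ge0//.
  exact: taylor_coef_bound.
Qed.

End gibbs_lindeberg.

(** * Moments of the standard Gaussian law *)

Section gaussian_moments.
Variable R : realType.
Local Notation mu := (@lebesgue_measure R).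
Local Notation gauss := (@normal_prob R 0 1).
Local Notation phi := (@normal_pdf R 0 1).

Let mphi : measurable_fun [set: R] phi.
Proof. exact: measurable_normal_pdf. Qed.

Let phi_ge0 x : 0 <= phi x.
Proof. exact: normal_pdf_ge0. Qed.

Let phi_RN : ae_eq mu setT (Radon_Nikodym (charge_of_finite_measure gauss) mu)
  (EFin \o phi).
Proof.
apply: integral_ae_eq => //=.
- by apply: Radon_Nikodym_integrable; exact: normal_prob_dominates.
- exact/measurable_EFinP.
- move=> E _ mE; rewrite -Radon_Nikodym_integral//; exact: normal_prob_dominates.
Qed.

(** The Gaussian law is defined by its density, which is therefore its
    Radon-Nikodym derivative, and integrals change variables accordingly. *)
Lemma ge0_integral_normal (f : R -> \bar R) : measurable_fun [set: R] f ->
  (forall x, 0 <= f x)%E ->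
  (\int[gauss]_x f x = \int[mu]_x (f x * (phi x)%:E))%E.
Proof.
move=> mf f0; have dom := normal_prob_dominates 0 (1 : R).
rewrite -(Radon_Nikodym_SigmaFinite.change_of_variables dom)//.
apply: ae_eq_integral => //.
- apply: emeasurable_funM => //.
  exact: measurable_int (Radon_Nikodym_SigmaFinite.f_integrable dom).
- by apply: emeasurable_funM => //; exact/measurable_EFinP.
- apply: ae_eqe_mul2l; apply: ae_eq_trans phi_RN.
  exact: ae_eq_Radon_Nikodym_SigmaFinite.
Qed.

Lemma integral_normal (f : R -> \bar R) : gauss.-integrable [set: R] f ->
  (\int[gauss]_x f x = \int[mu]_x (f x * (phi x)%:E))%E.
Proof.
move=> fi; have dom := normal_prob_dominates 0 (1 : R).
rewrite -(Radon_Nikodym_change_of_variables dom)//.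
have mf := measurable_int _ fi.
apply: ae_eq_integral => //.
- exact: emeasurable_funM.
- by apply: emeasurable_funM => //; exact/measurable_EFinP.
- exact: ae_eqe_mul2l.
Qed.

Lemma phiE x : phi x = normal_peak 1 * expR (- (x ^+ 2 / 2)).
Proof.
by rewrite normal_pdfE ?oner_neq0// /normal_fun subr0 expr1n mulNr.
Qed.

(** With [y = x^2 / 4] the density is a constant times [exp (- y) * exp (- y)], and
    the first factor absorbs the power because [y^(k+1) / (k+1)! <= exp y].  The
    second factor is the Gaussian density of variance two: the comparison yields
    integrability and decay at infinity at once. *)
Lemma power_phi_le k : exists2 C : R, 0 <= C &
  forall x, `|x| ^+ k * phi x <= C * normal_pdf 0 (Num.sqrt 2) x.
Proof.
(* The peaks normalize the two densities; the rest bounds [|x|^k exp (- y)]. *)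
pose C : R := normal_peak 1 * (1 + 4 ^+ k.+1 * k.+1`!%:R) / normal_peak (Num.sqrt 2).
have s2 : Num.sqrt 2 != 0 :> R by rewrite gt_eqF// sqrtr_gt0.
exists C.
  by rewrite !mulr_ge0// ?normal_peak_ge0// ?invr_ge0 ?normal_peak_ge0//
    addr_ge0// mulr_ge0// exprn_ge0.
move=> x; rewrite phiE normal_pdfE// /C /normal_fun subr0 sqr_sqrtr//.
rewrite [leRHS]mulrA divfK ?gt_eqF ?normal_peak_gt0//.
rewrite mulrCA -[leRHS]mulrA ler_wpM2l ?normal_peak_ge0//.
set y := x ^+ 2 / 4.
have y0 : 0 <= y by rewrite divr_ge0// sqr_ge0.
have -> : - (x ^+ 2 / 2) = - y + - y by rewrite /y; field.
have -> : - x ^+ 2 / (2 *+ 2) = - y by rewrite mulNr -mulr_natr -natrM.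
rewrite expRD mulrA ler_wpM2r ?expR_ge0//.
rewrite expRN ler_pdivrMr ?expR_gt0//.
have xk : `|x| ^+ k <= 1 + 4 ^+ k.+1 * y ^+ k.+1.
  have -> : 4 ^+ k.+1 * y ^+ k.+1 = `|x| ^+ (2 * k.+1).
    by rewrite -exprMn /y exprM real_normK ?num_real// mulrC divfK.
  have [x1|x1] := leP `|x| 1.
    by apply: (@le_trans _ _ 1); rewrite ?exprn_ile1// lerDl exprn_ge0.
  apply: (@le_trans _ _ (`|x| ^+ (2 * k.+1))); last by rewrite lerDr.
  by rewrite ler_weXn2l ?(ltW x1)//; lia.
apply: (le_trans xk).
rewrite mulrDl mul1r lerD//.
  by rewrite -[leLHS]expR0 ler_expR.
rewrite -mulrA ler_wpM2l ?exprn_ge0//.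
rewrite mulrC -ler_pdivrMr ?ltr0n ?fact_gt0//.
by rewrite (le_trans _ (expR_ge1Dxn k y0))// lerDr.
Qed.

Lemma integrable_power_phi k : mu.-integrable [set: R] (fun x => (x ^+ k * phi x)%:E).
Proof.
have [C C0 hC] := power_phi_le k.
have iC := integrableZl measurableT C (integrable_normal_pdf 0 (Num.sqrt 2 : R)).
apply: le_integrable iC => //.
  by apply/measurable_EFinP; exact: measurable_funM.
move=> x _ /=; rewrite lee_fin [leRHS]ger0_norm; last first.
  by rewrite mulr_ge0// normal_pdf_ge0.
by rewrite normrM normrX (ger0_norm (phi_ge0 x)).
Qed.

Lemma integrable_normal_moment k : gauss.-integrable [set: R] (fun x => (x ^+ k)%:E).
Proof.
apply/integrableP; split; first by apply/measurable_EFinP.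
rewrite ge0_integral_normal//; last first.
  by apply: measurableT_comp => //; exact/measurable_EFinP.
have /integrableP[_] := integrable_power_phi k.
apply: le_lt_trans; rewrite le_eqVlt; apply/orP; left; apply/eqP.
by apply: eq_integral => x _; rewrite -EFinM/= normrM (ger0_norm (phi_ge0 x)).
Qed.

Let moment k := \int[gauss]_x (x ^+ k).

Lemma momentE k : moment k = \int[mu]_x (x ^+ k * phi x).
Proof.
by rewrite /moment /Rintegral integral_normal//; exact: integrable_normal_moment.
Qed.

Lemma is_derive_phi (x : R) : is_derive x 1 phi (- (x * phi x)).
Proof.
have -> : phi = (fun x => normal_peak 1 * expR (- 2^-1 * x ^+ 2)).
  by apply/funext => z; rewrite phiE; congr (_ * expR _); ring.
apply: is_derive_eq (is_derive_ptMl _ (is_derive_pt_expR (is_derive_monomial _ 2 x))) _.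
by rewrite /= expr1; field.
Qed.

Let dprim m (x : R) : is_derive x 1 (fun x => x ^+ m * phi x)
  (m%:R * (x ^+ m.-1 * phi x) - x ^+ m.+1 * phi x).
Proof.
have dX : is_derive x 1 (fun x : R => x ^+ m) (m%:R * x ^+ m.-1).
  have := is_derive_monomial 1 m x; rewrite mul1r.
  by under eq_fun do rewrite mul1r.
apply: is_derive_eq (is_derive_ptM dX (is_derive_phi x)) _.
by rewrite exprS; ring.
Qed.

Let prim_continuous m : continuous (fun x : R => x ^+ m * phi x).
Proof.
move=> x; apply/differentiable_continuous/derivable1_diffP.
by case: (dprim m x).
Qed.

(** One more power than needed is bounded, which leaves a factor [1 / N]. *)
Let prim_cvg0 m : (fun N : nat => N.+1%:R ^+ m * phi N.+1%:R) @ \oo --> (0 : R).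
Proof.
have [C C0 hC] := power_phi_le m.+1.
pose A := C * normal_peak (Num.sqrt 2).
apply: (@squeeze_cvgr _ _ _ _ (fun=> 0) (fun N => A * N.+1%:R^-1)).
- apply: nearW => N; rewrite mulr_ge0//=.
  rewrite ler_pdivlMr ?ltr0n// -mulrA mulrCA [_ * (_ * _)]mulrC.
  rewrite -mulrA mulrCA mulrA -exprS.
  have := hC N.+1%:R; rewrite ger0_norm// => /le_trans; apply.
  by rewrite ler_wpM2l// normal_pdf_ub// gt_eqF// sqrtr_gt0.
- exact: cvg_cst.
- by rewrite -[X in _ --> X](mulr0 A); apply: cvgMl_tmp; exact: cvg_harmonic.
Qed.

(** The integrand is the derivative of [x^m phi x].  Its integral over [[-N, N]] is
    a boundary term that tends to 0, and also tends to the integral over the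
    line. *)
Let prim_integral m : \int[mu]_x (m%:R * (x ^+ m.-1 * phi x) - x ^+ m.+1 * phi x) = 0.
Proof.
pose g x := m%:R * (x ^+ m.-1 * phi x) - x ^+ m.+1 * phi x.
pose H x := x ^+ m * phi x.
have ig : mu.-integrable [set: R] (EFin \o g).
  apply: (eq_integrable measurableT _ _ _ (integrableB measurableT
    (integrableZl measurableT m%:R (integrable_power_phi m.-1))
    (integrable_power_phi m.+1))) => //.
have mg : measurable_fun [set: R] g by case/integrableP : ig => /measurable_EFinP.
have cg : continuous g.
  move=> x; apply: cvgB; last exact: prim_continuous.
  by apply: cvgMl_tmp; exact: prim_continuous.
have FTC (N : nat) :
    (\int[mu]_(x in `[(- N.+1%:R)%R, N.+1%:R%R]) (g x)%:E =
     (H N.+1%:R - H (- N.+1%:R))%:E)%E.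
  rewrite (@continuous_FTC2 _ g H)//.
  - by rewrite gtrN// ltr0n.
  - exact: continuous_subspaceT.
  - split => [x _||]; first by case: (dprim m x).
    + exact/cvg_at_right_filter/prim_continuous.
    + exact/cvg_at_left_filter/prim_continuous.
  - by move=> x _; rewrite derive1E; exact: (@derive_val _ _ _ _ _ _ _ (dprim m x)).
pose I (N : nat) := (\int[mu]_(x in `[(- N.+1%:R)%R, N.+1%:R%R]) (g x)%:E)%E.
have lim0 : I @ \oo --> 0%E.
  rewrite /I.
  under eq_fun do rewrite FTC; apply: cvg_EFin; first exact: nearW.
  have -> : (fine \o (fun N : nat => (H N.+1%:R - H (- N.+1%:R))%:E)) =
      (fun N : nat => (1 - (-1) ^+ m) * (N.+1%:R ^+ m * phi N.+1%:R)).
    by apply/funext => N /=; rewrite /H [phi (- _)]phiE sqrrN -phiE;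
      rewrite [(- N.+1%:R) ^+ m]exprNn mulrBl mul1r mulrA.
  by rewrite -[X in _ --> X](mulr0 (1 - (-1) ^+ m)); apply: cvgMl_tmp.
have limI : I @ \oo --> (\int[mu]_x (g x)%:E)%E.
  rewrite /I; under eq_fun do rewrite integral_mkcond.
  have [|||||//] := @dominated_convergence _ _ _ mu setT measurableT
    (fun N : nat => (EFin \o g) \_ `[- N.+1%:R, N.+1%:R]) (EFin \o g)
    (abse \o (EFin \o g)).
  - move=> N; apply/(measurable_restrictT _ _).1 => //.
    by apply/measurable_EFinP; exact: measurable_funTS.
  - exact/measurable_EFinP.
  - apply: aeW => x _; apply: cvg_near_cst.
    near=> N; rewrite patchE ifT// inE/= in_itv/= -ler_norml.
    apply: (@le_trans _ _ N%:R); last by rewrite ler_nat.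
    by near: N; exact: nbhs_infty_ger.
  - exact: integrable_abse.
  - apply: aeW => x N _; rewrite patchE; case: ifP => // _.
    by rewrite abse0 abse_ge0.
by rewrite /Rintegral (cvg_unique _ limI lim0).
Unshelve. all: by end_near. Qed.

(** Integration by parts, from [phi' x = - x phi x]; at [m = 0] it says that the mean
    is zero. *)
Lemma normal_moment_rec m : moment m.+1 = m%:R * moment m.-1.
Proof.
apply/esym/eqP; rewrite -subr_eq0 !momentE -RintegralZl//; last first.
  exact: integrable_power_phi.
rewrite -RintegralB ?prim_integral//; last exact: integrable_power_phi.
exact: (integrableZl measurableT m%:R (integrable_power_phi m.-1)).
Qed.

Lemma normal_moment0 : moment 0 = 1.
Proof.
rewrite momentE /Rintegral; under eq_integral do rewrite expr0 mul1r.
by rewrite integral_normal_pdf.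
Qed.

End gaussian_moments.

(** The Gaussian law, transported to the sigma-algebra of [R] in which random
    variables take their values.  The identity map does this. *)
Section gaussian_law.
Variable R : realType.

Let id_borel : measurableTypeR R -> R := idfun.

#[local] HB.instance Definition _ :=
  @isMeasurableFun.Build _ _ _ _ id_borel (@measurable_id _ _ setT).

Definition gaussian_law : probability R R :=
  distribution (@normal_prob R 0 1) (id_borel : {mfun _ >-> R}).

Lemma gaussian_lawE (B : set R) : gaussian_law B = normal_prob 0 1 B.
Proof. by []. Qed.

Lemma integrable_gaussian k :
  gaussian_law.-integrable [set: R] (fun u => (u ^+ k)%:E).
Proof.
apply/integrableP; split; first exact/measurable_EFinP.
have mk : measurable_fun [set: R] (fun u : R => `|(u ^+ k)%:E|%E).
  by apply: measurableT_comp => //; exact/measurable_EFinP.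
rewrite (ge0_integral_distribution _ mk)//.
by have /integrableP[] := integrable_normal_moment R k.
Qed.

Lemma gaussian_momentE k :
  \int[gaussian_law]_u (u ^+ k) = \int[normal_prob (0 : R) 1]_u (u ^+ k).
Proof.
rewrite /Rintegral integral_distribution//; last exact: integrable_normal_moment.
exact/measurable_EFinP.
Qed.

Lemma gaussian_moment_rec m :
  \int[gaussian_law]_u (u ^+ m.+1) = m%:R * \int[gaussian_law]_u (u ^+ m.-1).
Proof. by rewrite !gaussian_momentE normal_moment_rec. Qed.

Lemma gaussian_moment0 : \int[gaussian_law]_u (u ^+ 0) = 1.
Proof. by rewrite gaussian_momentE normal_moment0. Qed.

Lemma gaussian_moment1 : \int[gaussian_law]_u (u ^+ 1) = 0.
Proof. by rewrite gaussian_moment_rec mul0r. Qed.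

Lemma gaussian_moment2 : \int[gaussian_law]_u (u ^+ 2) = 1.
Proof. by rewrite gaussian_moment_rec mul1r gaussian_moment0. Qed.

Lemma gaussian_moment4 : \int[gaussian_law]_u (u ^+ 4) = 3.
Proof. by rewrite gaussian_moment_rec gaussian_moment2 mulr1. Qed.

Lemma gaussian_moment6 : \int[gaussian_law]_u (u ^+ 6) = 15.
Proof. by rewrite gaussian_moment_rec gaussian_moment4 -natrM. Qed.

Lemma gaussian_abs_moment3 : \int[gaussian_law]_u (`|u| ^+ 3) <= 2.
Proof.
have := abs_moment_le (integrable_gaussian (2 * 1)) (integrable_gaussian (2 * 2)).
by move=> /le_trans; apply; rewrite gaussian_moment2 gaussian_moment4; lra.
Qed.

Lemma gaussian_abs_moment5 : \int[gaussian_law]_u (`|u| ^+ 5) <= 9.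
Proof.
have := abs_moment_le (integrable_gaussian (2 * 2)) (integrable_gaussian (2 * 3)).
by move=> /le_trans; apply; rewrite gaussian_moment4 gaussian_moment6; lra.
Qed.

End gaussian_law.

(** * The truncated model as a finite linear energy *)

Section truncated_model.
Variables (R : realType) (N : nat) (t : nat -> R).
Implicit Types (x : site N -> R) (c : option bool) (s : config N) (i : site N).

Definition coupling_scale (p : nat) : R := (N%:R `^ ((p%:R - 1) / 2))^-1.

Definition truncated_hamiltonian x (j : bool) (beta : nat -> R) (h : R) m s : R :=
  \sum_(2 <= p < m) beta p *
    (Num.sqrt (t p) * pure_hamiltonian x None p s +
     Num.sqrt (1 - t p) * pure_hamiltonian x (Some j) p s) +
  h * \sum_(i < N) spin R s i.

(** The weight of family [c] in the energy of system [j]: the common family [None]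
    enters both systems, the private family [Some j'] only system [j']. *)
Definition share (j : bool) c (p : nat) : R :=
  if c is Some j' then (if j' == j then Num.sqrt (1 - t p) else 0)
  else Num.sqrt (t p).

(** The coefficient of the variable [x i] in the energy of system [j]. *)
Definition site_coef (j : bool) (beta : nat -> R) i s : R :=
  beta (size i.2) * share j i.1 (size i.2) * coupling_scale (size i.2) *
  \prod_(k <- i.2) spin R s k.

Definition level_sites (p : nat) : seq (site N) :=
  [seq (c, tval tau) | c <- [:: None; Some false; Some true],
                       tau <- enum {: p.-tuple 'I_N}].

Definition sites (m : nat) : seq (site N) :=
  flatten [seq level_sites p | p <- index_iota 2 m].

Lemma level_sites_size p i : i \in level_sites p -> size i.2 = p.
Proof. by case/allpairsP => -[c tau] /= [_ _ ->]; rewrite size_tuple. Qed.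

Lemma sites_active m i : i \in sites m -> @active N i.
Proof.
case/flattenP => l /mapP[p]; rewrite mem_index_iota => /andP[p2 _] ->.
by move=> /level_sites_size pE; rewrite /active/= pE.
Qed.

Lemma uniq_level_sites p : uniq (level_sites p).
Proof.
apply: allpairs_uniq => //; first exact: enum_uniq.
move=> [c tau] [c' tau'] _ _ /= [-> tt']; congr (_, _); exact: val_inj.
Qed.

Lemma uniq_sites m : uniq (sites m).
Proof.
have : uniq (index_iota 2 m) := iota_uniq _ _.
rewrite /sites; elim: (index_iota 2 m) => //= p l IH.
move=> /andP[pl ul]; rewrite cat_uniq uniq_level_sites IH//= andbT.
apply/hasPn => i /flattenP[_ /mapP[q ql ->]] /level_sites_size qE.
apply/negP => /level_sites_size pE; move: pl; rewrite -pE qE ql//.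
Qed.

Lemma sum_sites m (f : site N -> R) :
  \sum_(i <- sites m) f i =
  \sum_(2 <= p < m) (\sum_(tau : p.-tuple 'I_N) f (None, tval tau) +
    (\sum_(tau : p.-tuple 'I_N) f (Some false, tval tau) +
     \sum_(tau : p.-tuple 'I_N) f (Some true, tval tau))).
Proof.
rewrite /sites big_flatten/= big_map; apply: eq_bigr => p _.
by rewrite big_allpairs_dep/= !big_cons big_nil addr0 !big_enum.
Qed.

Lemma truncated_hamiltonian_linear x j beta h m s :
  truncated_hamiltonian x j beta h m s =
  h * \sum_(i < N) spin R s i + \sum_(i <- sites m) x i * site_coef j beta i s.
Proof.
rewrite addrC; congr (_ + _); rewrite sum_sites; apply: eq_bigr => p _.
have level c : \sum_(tau : p.-tuple 'I_N) x (c, tval tau) *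
      site_coef j beta (c, tval tau) s =
    beta p * (share j c p * pure_hamiltonian x c p s).
  rewrite /pure_hamiltonian !mulr_sumr; apply: eq_bigr => tau _.
  by rewrite /site_coef /= size_tuple -/(coupling_scale p); ring.
rewrite !level mulrDr; congr (_ + _).
by case: j {level}; rewrite /share/= mul0r mulr0 ?addr0 ?add0r.
Qed.

End truncated_model.

(** The two systems do not interact: their energies add up and the partition
    function of the pair is a product. *)
Lemma boltzmann_pair (R : realType) N (H1 H2 : config N -> R)
    (s : config N * config N) :
  boltzmann (fun s => H1 s.1 + H2 s.2) s = gibbs H1 s.1 * gibbs H2 s.2.
Proof.
rewrite /boltzmann /gibbs mulrACA -invfM -expRD; congr (_ / _).
rewrite big_distrlr/= pair_big/=.
by apply: eq_bigr => -[s1 s2] _ /=; rewrite expRD.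
Qed.

Section truncated_mean.
Variables (R : realType) (N : nat) (t beta1 beta2 : nat -> R) (h1 h2 : R) (n : nat).
Variable L : {ffun 'I_n -> config N * config N} -> R.

(** [gibbs_mean] with the series over the levels stopped at [m]. *)
Definition truncated_mean m (x : site N -> R) : R :=
  \sum_(r : {ffun 'I_n -> config N * config N}) L r * \prod_(l < n)
    (gibbs (truncated_hamiltonian t x false beta1 h1 m) (r l).1 *
     gibbs (truncated_hamiltonian t x true beta2 h2 m) (r l).2).

Definition pair_field (s : config N * config N) : R :=
  h1 * (\sum_(i < N) spin R s.1 i) + h2 * (\sum_(i < N) spin R s.2 i).

Definition pair_coef (i : site N) (s : config N * config N) : R :=
  site_coef t false beta1 i s.1 + site_coef t true beta2 i s.2.

Lemma truncated_mean_linear m x : truncated_mean m x =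
  replica_mean L (boltzmann (energy (sites N m) pair_field pair_coef x)).
Proof.
have -> : energy (sites N m) pair_field pair_coef x =
    (fun s => truncated_hamiltonian t x false beta1 h1 m s.1 +
              truncated_hamiltonian t x true beta2 h2 m s.2).
  apply/funext => s; rewrite !truncated_hamiltonian_linear.
  rewrite /energy /pair_field /pair_coef.
  under [X in _ + X = _]eq_bigr do rewrite mulrDr.
  by rewrite big_split/= addrACA.
rewrite /truncated_mean /replica_mean; apply: eq_bigr => r _; congr (_ * _).
by apply: eq_bigr => l _; rewrite boltzmann_pair.
Qed.

(** The modulus of a coefficient is the same for all configurations, as spins are
    signs; the two systems are added up. *)
Definition coef_bound (i : site N) : R :=
  (`|beta1 (size i.2)| * share t false i.1 (size i.2) +
   `|beta2 (size i.2)| * share t true i.1 (size i.2)) *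
  coupling_scale R N (size i.2).

Lemma share_ge0 j c p : 0 <= share t j c p.
Proof. by case: c => [j'|]; rewrite /share; [case: ifP|]; rewrite ?sqrtr_ge0. Qed.

Lemma coupling_scale_ge0 p : 0 <= coupling_scale R N p.
Proof. by rewrite invr_ge0 powR_ge0. Qed.

Lemma coef_bound_ge0 i : 0 <= coef_bound i.
Proof.
by rewrite mulr_ge0 ?coupling_scale_ge0// addr_ge0// mulr_ge0 ?share_ge0.
Qed.

Lemma norm_spin_prod (s : config N) (l : seq 'I_N) :
  `|\prod_(k <- l) spin R s k| = 1.
Proof.
rewrite normr_prod big1// => k _.
by rewrite /spin normrX normrN1 expr1n.
Qed.

Lemma pair_coef_bound i s : `|pair_coef i s| <= coef_bound i.
Proof.
rewrite (le_trans (ler_normD _ _))// /site_coef !normrM !norm_spin_prod !mulr1.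
rewrite !(ger0_norm (share_ge0 _ _ _)) (ger0_norm (coupling_scale_ge0 _)).
by rewrite -mulrDl.
Qed.

(** For [q >= 2] a share satisfies [(sqrt t)^q <= t].  The three families at level [p]
    thus weigh at most [t (b1 + b2)^q + (1 - t) (b1^q + b2^q)], and the last sum is
    at most [(b1 + b2)^q]. *)
Lemma sum_level_coef_bound q p : (2 <= q)%N -> 0 <= t p <= 1 ->
  0 <= beta1 p -> 0 <= beta2 p ->
  \sum_(tau : p.-tuple 'I_N) coef_bound (None, tval tau) ^+ q +
  (\sum_(tau : p.-tuple 'I_N) coef_bound (Some false, tval tau) ^+ q +
   \sum_(tau : p.-tuple 'I_N) coef_bound (Some true, tval tau) ^+ q) <=
  N%:R ^+ p * coupling_scale R N p ^+ q * (beta1 p + beta2 p) ^+ q.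
Proof.
move=> q2 /andP[t0 t1] b1 b2.
have level c : \sum_(tau : p.-tuple 'I_N) coef_bound (c, tval tau) ^+ q =
    N%:R ^+ p * coupling_scale R N p ^+ q *
    (beta1 p * share t false c p + beta2 p * share t true c p) ^+ q.
  rewrite -[N%:R ^+ p]natrX -[in (N ^ p)%N](card_ord N) -card_tuple -mulrA mulr_natl.
  rewrite -sumr_const; apply: eq_bigr => tau _.
  by rewrite /coef_bound/= size_tuple !ger0_norm// exprMn mulrC.
have sqrt_le (v : R) : 0 <= v -> v <= 1 -> Num.sqrt v ^+ q <= v.
  move=> v0 v1; rewrite -[leRHS](sqr_sqrtr v0); apply: ler_wiXn2l => //.
  by rewrite -sqrtr1 ler_sqrt.
have add_le : beta1 p ^+ q + beta2 p ^+ q <= (beta1 p + beta2 p) ^+ q.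
  case: q q2 {level sqrt_le} => // q _; rewrite [leRHS]exprS mulrDl !exprS lerD//;
    by rewrite ler_wpM2l// lerXn2r ?nnegrE ?addr_ge0// ?lerDl ?lerDr.
rewrite !level -!mulrDr ler_wpM2l//.
  by rewrite mulr_ge0// exprn_ge0// ?coupling_scale_ge0.
rewrite /share/= !mulr0 addr0 add0r -mulrDl !exprMn -mulrDl.
rewrite [leRHS](_ : _ = (beta1 p + beta2 p) ^+ q * t p +
    (beta1 p + beta2 p) ^+ q * (1 - t p)); last by ring.
have bq0 : 0 <= (beta1 p + beta2 p) ^+ q by rewrite exprn_ge0// addr_ge0.
apply: lerD; first by rewrite ler_wpM2l ?sqrt_le.
rewrite ler_pM ?addr_ge0 ?exprn_ge0 ?sqrtr_ge0// sqrt_le ?subr_ge0//.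
by rewrite lerBlDr lerDl.
Qed.

End truncated_mean.

Lemma level_weight (R : realType) (N p q : nat) : (0 < N)%N ->
  N%:R ^+ p * coupling_scale R N p ^+ q =
  N%:R `^ (p%:R - q%:R * ((p%:R - 1) / 2)).
Proof.
move=> N0; have N1 : (N%:R : R) != 0 by rewrite pnatr_eq0 -lt0n.
rewrite /coupling_scale exprVn -(powR_mulrn q (powR_ge0 _ _)) -powRrM -powRN.
by rewrite -powR_mulrn// -powRD ?N1 ?implybT// [q%:R * _]mulrC.
Qed.

(** * Almost sure convergence of the Hamiltonians *)

(** The sequence converges where the upper and lower limits are equal and finite, a
    measurable set; elsewhere [limn] is a constant. *)
Lemma measurable_limn d (T : measurableType d) (R : realType) (u : nat -> T -> R) :
  (forall m, measurable_fun [set: T] (u m)) ->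
  measurable_fun [set: T] (fun w => limn (fun m => u m w)).
Proof.
move=> mu; pose v m w := (u m w)%:E.
have mv m : measurable_fun [set: T] (v m) by exact/measurable_EFinP.
pose es w := limn_esup (v ^~ w); pose ei w := limn_einf (v ^~ w).
have mes : measurable_fun [set: T] es by exact: measurable_fun_limn_esup.
have mei : measurable_fun [set: T] ei.
  rewrite (_ : ei = -%E \o (fun w => limn_esup (fun m => (- v m w)%E))).
    apply: measurableT_comp => //; apply: measurable_fun_limn_esup => m.
    exact: measurableT_comp.
  apply/funext => w /=; rewrite /ei.
  have -> : (fun m => (- v m w)%E) = -%E \o (v ^~ w) by [].
  by rewrite limn_esupN oppeK.
have -> : (fun w => limn (fun m => u m w)) =
    (fun w => if (es w == ei w) && (es w \is a fin_num) then fine (es w) else point).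
  apply/funext => w; case: ifPn => [/andP[/eqP esi fes]|].
    apply/cvg_lim => //; apply: (@fine_cvg _ _ _ _ (fun m => v m w)).
    rewrite fineK//.
    apply: (@squeeze_cvge _ _ _ _ (einfs (v ^~ w)) _ (esups (v ^~ w))).
    - apply: nearW => m; apply/andP; split.
        by apply: ereal_inf_lbound; exists m => /=.
      by apply: ereal_sup_ubound; exists m => /=.
    - rewrite esi /ei limn_einf_lim; exact: is_cvg_einfs.
    - rewrite /es limn_esup_lim; exact: is_cvg_esups.
  apply: contraNeq => h.
  have cu : cvgn (fun m => u m w).
    by apply: contrapT => /dvgP h'; move: h; rewrite h' eqxx.
  have /cvg_ex[l ul] := cu.
  have vl : (fun m => v m w) @ \oo --> l%:E by apply: cvg_EFin => //; exact: nearW.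
  by rewrite /es /ei !(cvg_limn_einf_sup vl) eqxx.
apply: measurable_fun_ifT => //.
- apply: measurable_and; first exact: measurable_fun_eqe.
  by apply: (measurable_fun_bool true); exact: emeasurable_fin_num.
- exact: (measurableT_comp (fine_measurable measurableT)).
Qed.

(** By monotone convergence the series of absolute values has a finite mean, so it
    is finite almost surely. *)
Lemma ae_cvg_series d (T : measurableType d) (R : realType) (P : probability T R)
    (u : nat -> T -> R) (b : nat -> R) :
  (forall p, measurable_fun [set: T] (u p)) ->
  (forall p, \int[P]_w `|u p w|%:E <= (b p)%:E)%E ->
  (\sum_(p <oo) (b p)%:E < +oo)%E ->
  {ae P, forall w, cvgn (series (u ^~ w))}.
Proof.
move=> mu ub bsum.
have mau p : measurable_fun [set: T] (fun w => `|u p w|%:E).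
  by apply/measurable_EFinP; exact: measurableT_comp.
have iS : P.-integrable [set: T] (fun w => \sum_(p <oo) `|u p w|%:E)%E.
  apply/integrableP; split; first exact: ge0_emeasurable_sum.
  under eq_integral => w _.
    rewrite gee0_abs; last by apply: nneseries_ge0 => p _ _; rewrite lee_fin.
    over.
  rewrite integral_nneseries//.
  apply: le_lt_trans bsum; apply: lee_nneseries => // p _ _.
  by apply: integral_ge0 => w _; rewrite lee_fin.
apply: filterS (integrable_ae measurableT iS) => w /(_ Logic.I) fin_w.
apply: normed_cvg; apply: nondecreasing_is_cvgn.
  by apply: (@nondecreasing_series _ (fun p => `|u p w|) predT 0%N).
exists (fine (\sum_(p <oo) `|u p w|%:E)%E) => _ [m _ <-].
rewrite -lee_fin fineK// /series/= -sumEFin.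
by apply: nneseries_lim_ge => p _ _; rewrite lee_fin.
Qed.

Section second_moment.
Context d (T : measurableType d) (R : realType) (P : probability T R).
Variables (N : nat) (Z : site N -> {RV P >-> R}) (lam : probability R R).
Hypotheses (N_gt0 : (0 < N)%N)
  (Z_indep : mutually_independent (@active N) Z)
  (Z_law : forall i, active i ->
     forall B, measurable B -> distribution P (Z i) B = lam B)
  (lam_int : forall j, (j <= 2)%N ->
     lam.-integrable [set: R] (fun u => (u ^+ j)%:E))
  (lam1 : \int[lam]_u (u ^+ 1) = 0) (lam2 : \int[lam]_u (u ^+ 2) = 1).

(** Distinct centered variables are independent, hence uncorrelated. *)
Lemma second_moment i j : active i -> active j ->
  P.-integrable [set: T] (fun w => (Z i w * Z j w)%:E) /\
  \int[P]_w (Z i w * Z j w) = (i == j)%:R.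
Proof.
move=> Di Dj; have [<-|ij] := eqVneq i j.
  have := integrable_law (Z_law Di) (lam_int (leqnn 2)).
  have := Rintegral_law (Z_law Di) (lam_int (leqnn 2)).
  by rewrite lam2 => h1 h2; split.
have iZ k : active k -> P.-integrable [set: T] (EFin \o Z k).
  by move=> Dk; exact: (integrable_law (f := fun u => u ^+ 1) (Z_law Dk)
    (lam_int (leqnSn 1))).
have mZ k : measurable_fun [set: T] (Z k) by exact: measurable_funP.
have ij_indep A B : measurable A -> measurable B ->
    P (Z i @^-1` A `&` Z j @^-1` B) = (P (Z i @^-1` A) * P (Z j @^-1` B))%E.
  move=> mA mB.
  have := @mutually_independent_functional _ _ _ _ _ _ _ Z_indep [fset i]%fset j
    (fun x => x i) _ Dj _ _ _ _ mA mB.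
  rewrite /restrict_family /= fset11; apply; last by move=> d' T' Z'; exact.
    by move=> k /=; rewrite inE => /eqP ->.
  by rewrite inE eq_sym.
split; first exact: integrable_indepM (mZ i) (mZ j) ij_indep (iZ _ Di) (iZ _ Dj).
rewrite (Rintegral_indepM (mZ i) (mZ j) ij_indep (iZ _ Di) (iZ _ Dj)).
have -> : \int[P]_w Z i w = 0; last by rewrite mul0r.
by rewrite -lam1 -(Rintegral_law (Z_law Di) (lam_int (leqnSn 1))).
Qed.

(** Only the diagonal of the square survives in the mean, which leaves [N^p] terms
    of size [N^(-(p-1))], that is [N].  The bound follows from [|H| <= 1 + H^2],
    which avoids the Cauchy-Schwarz inequality. *)
Lemma pure_hamiltonian_mean c p s : (2 <= p)%N ->
  (\int[P]_w `|pure_hamiltonian (fun i => Z i w) c p s|%:E <= (1 + N%:R)%:E)%E.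
Proof.
move=> p2; pose e (tau : p.-tuple 'I_N) := \prod_(k <- tau) spin R s k.
pose H w := pure_hamiltonian (fun i => Z i w) c p s.
pose cs := coupling_scale R N p.
have act (tau : p.-tuple 'I_N) : active (c, tval tau).
  by rewrite /active/= size_tuple.
have mH : measurable_fun [set: T] H.
  apply: measurable_funM => //; apply: measurable_sum => tau.
  by apply: measurable_funM => //; exact: measurable_funP.
have H2E w : H w ^+ 2 = \sum_tau \sum_tau' (cs ^+ 2 * (e tau * e tau')) *
    (Z (c, tval tau) w * Z (c, tval tau') w).
  rewrite /H /pure_hamiltonian exprMn expr2 -[X in X * X]/cs -expr2 -/cs.
  rewrite [X in _ * X]expr2 big_distrlr/= mulr_sumr; apply: eq_bigr => tau _.
  by rewrite mulr_sumr; apply: eq_bigr => tau' _; rewrite /e; ring.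
have iT tau tau' : P.-integrable [set: T] (EFin \o (fun w =>
    (cs ^+ 2 * (e tau * e tau')) * (Z (c, tval tau) w * Z (c, tval tau') w))).
  have [h _] := second_moment (act tau) (act tau').
  exact: (integrableZl measurableT (cs ^+ 2 * (e tau * e tau')) h).
have isum tau : P.-integrable [set: T] (EFin \o (fun w => \sum_tau'
    (cs ^+ 2 * (e tau * e tau')) * (Z (c, tval tau) w * Z (c, tval tau') w))).
  exact: integrable_sumR.
have iH2 : P.-integrable [set: T] (EFin \o (fun w => H w ^+ 2)).
  under eq_fun do rewrite H2E.
  exact: integrable_sumR.
have EH2 : \int[P]_w (H w ^+ 2) = N%:R.
  under eq_Rintegral do rewrite H2E.
  rewrite Rintegral_sum//.
  transitivity (\sum_(tau : p.-tuple 'I_N) cs ^+ 2).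
    apply: eq_bigr => tau _; rewrite Rintegral_sum// (bigD1 tau)//=.
    rewrite big1 ?addr0 => [|tau' tt'].
      rewrite RintegralZl//; last by case: (second_moment (act tau) (act tau)).
      have [_ ->] := second_moment (act tau) (act tau).
      rewrite eqxx mulr1 -expr2.
      by rewrite -(real_normK (num_real (e tau))) norm_spin_prod expr1n mulr1.
    rewrite RintegralZl//; last by case: (second_moment (act tau) (act tau')).
    have [_ ->] := second_moment (act tau) (act tau').
    rewrite (_ : _ == _ = false) ?mulr0//.
    by apply/negbTE; apply: contra tt' => /eqP[] /val_inj ->.
  rewrite sumr_const card_tuple card_ord -[LHS]mulr_natl natrX.
  rewrite level_weight// -[RHS]powRr1//; congr (_ `^ _).
  by field.
have iB : P.-integrable [set: T] (EFin \o (fun w => 1 + H w ^+ 2)).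
  apply: (eq_integrable measurableT _ _ _ (integrableD measurableT
    (finite_measure_integrable_cst P 1 measurableT) iH2)) => //.
apply: (@le_trans _ _ (\int[P]_w (1 + H w ^+ 2)%:E)%E).
  apply: ge0_le_integral => //.
  - by apply/measurable_EFinP; exact: measurableT_comp.
  - by case/integrableP: iB.
  - move=> w _; rewrite lee_fin -(real_normK (num_real (H w))).
    nra.
rewrite -[leLHS]fineK; last exact: integrable_fin_num iB.
rewrite lee_fin -/(Rintegral P setT _).
rewrite RintegralD//; last exact: finite_measure_integrable_cst.
rewrite EH2 Rintegral_cst// (_ : fine _ = 1) ?mulr1//.
by rewrite -[RHS]/(fine 1%E); congr fine; exact: probability_setT.
Qed.

End second_moment.

Section hamiltonian_functionals.
Variables (R : realType) (N : nat) (t : nat -> R).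

Lemma measurable_functional_pure c p (s : config N) :
  measurable_functional (fun x : site N -> R => pure_hamiltonian x c p s).
Proof.
move=> d T Z mZ; apply: measurable_funM => //; apply: measurable_sum => tau.
exact: measurable_funM.
Qed.

Lemma measurable_functional_level j beta p (s : config N) :
  measurable_functional (fun x : site N -> R => beta p *
    (Num.sqrt (t p) * pure_hamiltonian x None p s +
     Num.sqrt (1 - t p) * pure_hamiltonian x (Some j) p s)).
Proof.
move=> d T Z mZ; apply: measurable_funM => //.
by apply: measurable_funD; apply: measurable_funM => //;
  exact: measurable_functional_pure.
Qed.

Lemma measurable_functional_hamiltonian j beta h (s : config N) :
  measurable_functional (fun x : site N -> R => hamiltonian x t j beta h s).
Proof.
move=> d T Z mZ; apply: measurable_funD => //.
apply: measurable_limn => m; apply: measurable_sum => p.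
exact: (measurable_functional_level j beta p s mZ).
Qed.

Lemma gibbs_meanE beta1 beta2 h1 h2 n
    (L : {ffun 'I_n -> config N * config N} -> R) (x : site N -> R) :
  gibbs_mean x t beta1 beta2 h1 h2 L =
  replica_mean L (boltzmann (fun s : config N * config N =>
    hamiltonian x t false beta1 h1 s.1 + hamiltonian x t true beta2 h2 s.2)).
Proof.
rewrite /gibbs_mean /replica_mean; apply: eq_bigr => r _; congr (_ * _).
by apply: eq_bigr => l _; rewrite boltzmann_pair.
Qed.

Lemma measurable_functional_gibbs_mean beta1 beta2 h1 h2 n
    (L : {ffun 'I_n -> config N * config N} -> R) :
  measurable_functional (fun x : site N -> R => gibbs_mean x t beta1 beta2 h1 h2 L).
Proof.
move=> d T Z mZ; under eq_fun do rewrite gibbs_meanE.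
apply: (@measurable_functional_replica_mean _ _ _ _ L (fun x s =>
  hamiltonian x t false beta1 h1 s.1 + hamiltonian x t true beta2 h2 s.2)) mZ => s.
by move=> d' T' Z' mZ'; apply: measurable_funD;
  exact: measurable_functional_hamiltonian.
Qed.

Let s0 : config N * config N := ([ffun=> true], [ffun=> true]).

Lemma gibbs_mean_bound beta1 beta2 h1 h2 n
    (L : {ffun 'I_n -> config N * config N} -> R) (x : site N -> R) :
  (forall r, `|L r| <= 1) -> `|gibbs_mean x t beta1 beta2 h1 h2 L| <= 1.
Proof.
move=> L1; rewrite gibbs_meanE; apply: replica_mean_bound => // [s|].
  exact: boltzmann_ge0.
exact: boltzmann_sum1 s0.
Qed.

Lemma truncated_mean_bound beta1 beta2 h1 h2 n m
    (L : {ffun 'I_n -> config N * config N} -> R) (x : site N -> R) :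
  (forall r, `|L r| <= 1) -> `|truncated_mean t beta1 beta2 h1 h2 L m x| <= 1.
Proof.
move=> L1; rewrite truncated_mean_linear; apply: replica_mean_bound => // [s|].
  exact: boltzmann_ge0.
exact: boltzmann_sum1 s0.
Qed.

Lemma measurable_functional_truncated_mean beta1 beta2 h1 h2 n m
    (L : {ffun 'I_n -> config N * config N} -> R) :
  measurable_functional (truncated_mean t beta1 beta2 h1 h2 L m).
Proof.
move=> d T Z mZ; under eq_fun do rewrite truncated_mean_linear.
apply: measurable_functional_replica_mean mZ => s.
exact: measurable_functional_energy.
Qed.

Lemma gibbs_cvg (H_ : nat -> config N -> R) (H : config N -> R) s :
  (forall s, H_ m s @[m --> \oo] --> H s) ->
  gibbs (H_ m) s @[m --> \oo] --> gibbs H s.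
Proof.
move=> HH; have eH s' : expR (H_ m s') @[m --> \oo] --> expR (H s').
  by apply: (cvg_comp _ expR (HH s')); exact: continuous_expR.
apply: cvgM; first exact: eH.
apply: cvgV; first by rewrite gt_eqF// (partition_gt0 H s).
by apply: cvg_big => [|s' _]; [exact: add_continuous|exact: eH].
Qed.

Lemma gibbs_mean_cvg beta1 beta2 h1 h2 n
    (L : {ffun 'I_n -> config N * config N} -> R) (x : site N -> R) :
  (forall s, truncated_hamiltonian t x false beta1 h1 m s @[m --> \oo] -->
     hamiltonian x t false beta1 h1 s) ->
  (forall s, truncated_hamiltonian t x true beta2 h2 m s @[m --> \oo] -->
     hamiltonian x t true beta2 h2 s) ->
  truncated_mean t beta1 beta2 h1 h2 L m x @[m --> \oo] -->
  gibbs_mean x t beta1 beta2 h1 h2 L.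
Proof.
move=> c1 c2; apply: cvg_big => [|r _]; first exact: add_continuous.
apply: cvgMl_tmp; apply: cvg_big => [|l _]; first exact: mul_continuous.
by apply: cvgM; exact: gibbs_cvg.
Qed.

End hamiltonian_functionals.

Section truncation_limit.
Context d (T : measurableType d) (R : realType) (P : probability T R).
Variables (N : nat) (Z : site N -> {RV P >-> R}) (lam : probability R R).
Hypotheses (N_gt0 : (0 < N)%N)
  (Z_indep : mutually_independent (@active N) Z)
  (Z_law : forall i, active i ->
     forall B, measurable B -> distribution P (Z i) B = lam B)
  (lam_int : forall j, (j <= 2)%N ->
     lam.-integrable [set: R] (fun u => (u ^+ j)%:E))
  (lam1 : \int[lam]_u (u ^+ 1) = 0) (lam2 : \int[lam]_u (u ^+ 2) = 1).
Variable t : nat -> R.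
Hypothesis t_01 : forall p, (2 <= p)%N -> 0 <= t p <= 1.

Let mZ i : measurable_fun [set: T] (Z i).
Proof. exact: measurable_funP. Qed.

(** The mean absolute value of the level [p] is at most [2 (1 + N) beta p], and
    [beta p <= 2^p (beta p)^2 + 2^(-p)] is summable. *)
Lemma ae_hamiltonian_cvg j (beta : nat -> R) h s :
  (forall p, (2 <= p)%N -> 0 <= beta p) ->
  (\sum_(2 <= p <oo) (2 ^+ p * beta p ^+ 2)%:E < +oo)%E ->
  {ae P, forall w,
    truncated_hamiltonian t (Z ^~ w) j beta h m s @[m --> \oo] -->
    hamiltonian (Z ^~ w) t j beta h s}.
Proof.
move=> beta_ge0 beta_sum.
pose X c p w := pure_hamiltonian (fun i => Z i w) c p s.
pose v p w :=
  beta p * (Num.sqrt (t p) * X None p w + Num.sqrt (1 - t p) * X (Some j) p w).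
(* The levels below two are filled with zeros, to have a series starting at 0. *)
pose u p w := if (2 <= p)%N then v p w else 0.
pose K : R := 2 * (1 + N%:R).
(* The term [2 / 2^(p+1)] is [2^(-p)], in a form whose sum over [p] is known. *)
pose b p : R :=
  K * ((if (2 <= p)%N then 2 ^+ p * beta p ^+ 2 else 0) + 2 / (2 ^ p.+1)%:R).
have K0 : 0 <= K by rewrite mulr_ge0// addr_ge0.
have c0 p : 0 <= (if (2 <= p)%N then 2 ^+ p * beta p ^+ 2 else 0) :> R.
  by case: ifP => // _; rewrite mulr_ge0 ?sqr_ge0// exprn_ge0.
have mu p : measurable_fun [set: T] (u p).
  rewrite /u; case: (2 <= p)%N => //.
  exact: (measurable_functional_level t j beta p s mZ).
have b_sum : (\sum_(p <oo) (b p)%:E < +oo)%E.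
  under eq_eseriesr do rewrite /b EFinM EFinD.
  rewrite nneseriesZl; last by move=> p _; rewrite adde_ge0 ?lee_fin ?divr_ge0.
  apply: lte_mul_pinfty; rewrite ?lee_fin//.
  rewrite nneseriesD => [|p _ _|p _ _]; rewrite ?lee_fin ?divr_ge0//.
  rewrite lte_add_pinfty//; last first.
    by rewrite (le_lt_trans (epsilon_trick0 _ _))// ltry.
  apply: le_lt_trans beta_sum; rewrite le_eqVlt; apply/orP; left; apply/eqP.
  rewrite [RHS]eseries_cond [RHS]eseries_mkcond.
  by apply: eq_eseriesr => p _ /=; case: ifP.
have u_b p : (\int[P]_w `|u p w|%:E <= (b p)%:E)%E.
  rewrite /u /b; have [p2|p2] := boolP (2 <= p)%N; last first.
    under eq_integral do rewrite normr0.
    by rewrite integral0 lee_fin mulr_ge0// add0r divr_ge0.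
  have /andP[tp0 tp1] := t_01 p2.
  have sqrt1 (r : R) : 0 <= r -> r <= 1 -> Num.sqrt r <= 1.
    by move=> r0 r1; rewrite -sqrtr1 ler_sqrt.
  have mX c : measurable_fun [set: T] (fun w => `|X c p w|%:E).
    apply/measurable_EFinP; apply: measurableT_comp => //.
    exact: (measurable_functional_pure c p s mZ).
  apply: (@le_trans _ _
      (\int[P]_w ((beta p)%:E * (`|X None p w|%:E + `|X (Some j) p w|%:E)))%E).
    apply: ge0_le_integral => //.
    - apply/measurable_EFinP; apply: measurableT_comp => //.
      exact: (measurable_functional_level t j beta p s mZ).
    - by apply: emeasurable_funM => //; exact: emeasurable_funD.
    - move=> w _; rewrite -EFinD -EFinM lee_fin /v normrM ger0_norm ?beta_ge0//.
      rewrite ler_wpM2l ?beta_ge0// (le_trans (ler_normD _ _))// !normrM.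
      rewrite !(ger0_norm (sqrtr_ge0 _)) lerD// ler_piMl// sqrt1 ?subr_ge0//.
      by rewrite lerBlDr lerDl.
  rewrite ge0_integralZl//; last 3 first.
  - exact: emeasurable_funD.
  - by move=> w _; rewrite adde_ge0 ?lee_fin.
  - by rewrite lee_fin beta_ge0.
  rewrite ge0_integralD//.
  apply: (@le_trans _ _ ((beta p)%:E * ((1 + N%:R)%:E + (1 + N%:R)%:E))%E).
    rewrite lee_wpmul2l ?lee_fin ?beta_ge0//.
    by apply: leeD;
      exact: (pure_hamiltonian_mean N_gt0 Z_indep Z_law lam_int lam1 lam2).
  rewrite -EFinD -EFinM lee_fin /K.
  rewrite (_ : beta p * _ = 2 * (1 + N%:R) * beta p); last by ring.
  rewrite ler_wpM2l//.
  have -> : 2 / (2 ^ p.+1)%:R = (2 ^+ p)^-1 :> R.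
    by rewrite expnS natrM natrX invfM mulrA divff// mul1r.
  have := beta_ge0 p p2; set B := beta p => B0.
  have x0 : 0 < 2 ^+ p :> R by rewrite exprn_gt0.
  have xx : 2 ^+ p * (2 ^+ p)^-1 = 1 :> R by rewrite divff// gt_eqF.
  have y0 : 0 < (2 ^+ p)^-1 :> R by rewrite invr_gt0.
  move: x0 xx y0; set x := 2 ^+ p; set y := x^-1 => x0 xx y0.
  (* With [x = 2^p], [y = 1 / x]: this gives [2 B <= x B^2 + y]. *)
  have : 0 <= y * (x * B - 1) ^+ 2 by rewrite mulr_ge0 ?sqr_ge0// ltW.
  have -> : y * (x * B - 1) ^+ 2 = x * y * (x * B ^+ 2 - 2 * B) + y by ring.
  by rewrite xx mul1r; lra.
have := ae_cvg_series mu u_b b_sum; apply: filterS => w cu.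
rewrite /truncated_hamiltonian /hamiltonian.
apply: cvgD; last exact: cvg_cst.
have -> : (fun m => \sum_(2 <= p < m) beta p *
     (Num.sqrt (t p) * pure_hamiltonian (Z ^~ w) None p s +
      Num.sqrt (1 - t p) * pure_hamiltonian (Z ^~ w) (Some j) p s)) =
    series (u ^~ w).
  apply/funext => m; rewrite /series/= (@big_nat_widenl _ _ _ _ 0)// big_mkcond/=.
  by apply: eq_bigr.
exact: cu.
Qed.

Variables (beta1 beta2 : nat -> R) (h1 h2 : R) (n : nat)
  (L : {ffun 'I_n -> config N * config N} -> R).
Hypotheses (beta1_ge0 : forall p, (2 <= p)%N -> 0 <= beta1 p)
  (beta2_ge0 : forall p, (2 <= p)%N -> 0 <= beta2 p)
  (beta1_sum : (\sum_(2 <= p <oo) (2 ^+ p * beta1 p ^+ 2)%:E < +oo)%E)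
  (beta2_sum : (\sum_(2 <= p <oo) (2 ^+ p * beta2 p ^+ 2)%:E < +oo)%E)
  (L_le1 : forall r, `|L r| <= 1).

Lemma expectation_gibbs_mean :
  ('E_P[fun w => gibbs_mean (fun i => Z i w) t beta1 beta2 h1 h2 L] =
   (\int[P]_w gibbs_mean (fun i => Z i w) t beta1 beta2 h1 h2 L)%:E)%E.
Proof.
rewrite unlock /Rintegral fineK//; apply: integrable_fin_num => //.
apply: (bounded_integrable P (B := 1)).
  exact: (measurable_functional_gibbs_mean t beta1 beta2 h1 h2 L mZ).
by move=> w; exact: gibbs_mean_bound.
Qed.

(** Dominated convergence: the averages are bounded by 1, and configurations are
    finite in number, so that almost surely all Hamiltonians converge together. *)
Lemma cvg_truncated_mean :
  (\int[P]_w truncated_mean t beta1 beta2 h1 h2 L m (Z ^~ w)) @[m --> \oo] -->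
  \int[P]_w gibbs_mean (fun i => Z i w) t beta1 beta2 h1 h2 L.
Proof.
pose F m w := truncated_mean t beta1 beta2 h1 h2 L m (Z ^~ w).
pose f w := gibbs_mean (fun i => Z i w) t beta1 beta2 h1 h2 L.
have mF m : measurable_fun [set: T] (F m).
  exact: (measurable_functional_truncated_mean t beta1 beta2 h1 h2 m L mZ).
have mf : measurable_fun [set: T] f.
  exact: (measurable_functional_gibbs_mean t beta1 beta2 h1 h2 L mZ).
have ae_cvg : {ae P, forall w, F m w @[m --> \oo] --> f w}.
  have cvg1 : {ae P, forall w, forall s : config N,
      truncated_hamiltonian t (Z ^~ w) false beta1 h1 m s @[m --> \oo] -->
      hamiltonian (Z ^~ w) t false beta1 h1 s}.
    by apply: filter_forall => s; exact: ae_hamiltonian_cvg.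
  have cvg2 : {ae P, forall w, forall s : config N,
      truncated_hamiltonian t (Z ^~ w) true beta2 h2 m s @[m --> \oo] -->
      hamiltonian (Z ^~ w) t true beta2 h2 s}.
    by apply: filter_forall => s; exact: ae_hamiltonian_cvg.
  apply: filterS2 cvg1 cvg2 => w c1 c2; exact: gibbs_mean_cvg.
have [|||||_ _ +] := @dominated_convergence _ _ _ P setT measurableT
    (fun m => EFin \o F m) (EFin \o f) (cst 1%E).
- by move=> m; exact/measurable_EFinP.
- exact/measurable_EFinP.
- apply: filterS ae_cvg => w cw _.
  by apply: cvg_EFin; [exact: nearW|exact: cw].
- exact: finite_measure_integrable_cst.
- apply: aeW => w m _ /=; rewrite lee_fin; exact: truncated_mean_bound.
move=> h; apply: (@fine_cvg _ _ _ _ (fun m => \int[P]_w (F m w)%:E)%E).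
rewrite fineK//; apply: integrable_fin_num => //.
by apply: (bounded_integrable P mf (B := 1)) => w; exact: gibbs_mean_bound.
Qed.

End truncation_limit.

(** * Comparison of the truncated models *)

Section truncated_comparison.
Context d d' (T : measurableType d) (T' : measurableType d') (R : realType).
Variables (P : probability T R) (P' : probability T' R) (N n : nat).
Variables (Y : site N -> {RV P >-> R}) (G : site N -> {RV P' >-> R}).
Variables (mu : probability R R).
Let nu : probability R R := gaussian_law R.
Hypotheses (Y_indep : mutually_independent (@active N) Y)
  (G_indep : mutually_independent (@active N) G)
  (Y_law : forall i, active i ->
     forall B, measurable B -> distribution P (Y i) B = mu B)
  (G_law : forall i, active i ->
     forall B, measurable B -> distribution P' (G i) B = nu B).
Variables (beta1 beta2 t : nat -> R) (h1 h2 : R)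
  (L : {ffun 'I_n -> config N * config N} -> R).
Hypotheses (N_gt0 : (1 <= N)%N) (n_gt0 : (1 <= n)%N)
  (beta1_ge0 : forall p, (2 <= p)%N -> 0 <= beta1 p)
  (beta2_ge0 : forall p, (2 <= p)%N -> 0 <= beta2 p)
  (t_01 : forall p, (2 <= p)%N -> 0 <= t p <= 1)
  (L_le1 : forall r, `|L r| <= 1).

Let kap := coef_bound (N := N) t beta1 beta2.
Let gap m :=
  `|\int[P']_w truncated_mean t beta1 beta2 h1 h2 L m (G ^~ w) -
    \int[P]_w truncated_mean t beta1 beta2 h1 h2 L m (Y ^~ w)|.
Let s0 : config N * config N := ([ffun=> true], [ffun=> true]).

Lemma truncated_lindeberg K m :
  (forall j, (j <= K)%N -> mu.-integrable [set: R] (fun u => (u ^+ j)%:E)) ->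
  (forall j, (j <= K)%N -> \int[mu]_u (u ^+ j) = \int[nu]_u (u ^+ j)) ->
  gap m <= \sum_(i <- sites N m)
    (\int[mu]_u remainder_bound K (2 * n%:R * kap i * u) +
     \int[nu]_u remainder_bound K (2 * n%:R * kap i * u)).
Proof.
move=> mu_int mu_nu; rewrite /gap.
have E x : truncated_mean t beta1 beta2 h1 h2 L m x =
    replica_mean L (boltzmann (energy (sites N m) (pair_field h1 h2)
      (pair_coef t beta1 beta2) x)) by exact: truncated_mean_linear.
under eq_Rintegral do rewrite E.
under [X in `|_ - X|]eq_Rintegral do rewrite E.
apply: (gibbs_lindeberg Y_indep G_indep Y_law G_law s0) => //.
- exact: uniq_sites.
- exact: sites_active.
- exact: pair_coef_bound.
- by move=> j _; exact: integrable_gaussian.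
Qed.

(** A level may be skipped when both of its inverse temperatures vanish; this is how
    the first part avoids the levels two and three. *)
Lemma sum_sites_coef_bound q m (e : R) : (2 <= q)%N ->
  (forall p, (2 <= p)%N -> beta1 p + beta2 p = 0 \/
     p%:R - q%:R * ((p%:R - 1) / 2) <= e) ->
  \sum_(i <- sites N m) kap i ^+ q <=
  N%:R `^ e * \sum_(2 <= p < m) (beta1 p + beta2 p) ^+ q.
Proof.
move=> q2 pe; rewrite sum_sites mulr_sumr.
rewrite big_nat_cond [leRHS]big_nat_cond; apply: ler_sum => p.
rewrite andbT => /andP[p2 _].
have b1 := beta1_ge0 p2; have b2 := beta2_ge0 p2.
apply: (le_trans (sum_level_coef_bound N q2 (t_01 p2) b1 b2)).
have [->|le_e] := pe p p2.
  by rewrite expr0n -(subnKC q2) /= !mulr0.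
rewrite level_weight// ler_wpM2r//; first by rewrite exprn_ge0// addr_ge0.
by rewrite ler_powR// ler1n.
Qed.

Let scale_pow q (k u : R) : 0 <= k ->
  `|2 * n%:R * k * u| ^+ q = (2 * n%:R) ^+ q * k ^+ q * `|u| ^+ q.
Proof. by move=> k0; rewrite normrM ger0_norm ?mulr_ge0// !exprMn. Qed.

Let kap_ge0 i : 0 <= kap i.
Proof. exact: coef_bound_ge0. Qed.

Let mrho (lam : probability R R) K i :
  lam.-integrable [set: R] (fun u => (u ^+ K)%:E) ->
  lam.-integrable [set: R]
    (EFin \o (fun u => remainder_bound K (2 * n%:R * kap i * u))).
Proof. by move=> iK; exact: (integrable_remainder_bound n kap i iK). Qed.

(** The remainder of order three is [8 n^3 k^3 |u|^3].  The mean of [|u|^3] is [M >= 1]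
    for [mu], and at most [2 <= 2 M] for the Gaussian, hence the constant [24]. *)
Lemma truncated_gap_third m :
  mu.-integrable [set: R] (fun u => (u ^+ 3)%:E) ->
  \int[mu]_u (u ^+ 1) = 0 -> \int[mu]_u (u ^+ 2) = 1 ->
  (forall p, (2 <= p < 4)%N -> beta1 p + beta2 p = 0) ->
  gap m <= 24 * n%:R ^+ 3 * \int[mu]_u (`|u| ^+ 3) * (N%:R `^ (1 / 2))^-1 *
    \sum_(2 <= p < m) (beta1 p + beta2 p) ^+ 3.
Proof.
move=> i3 m1 m2 b23.
have imu j : (j <= 2)%N -> mu.-integrable [set: R] (fun u => (u ^+ j)%:E).
  by move=> j2; apply: integrable_lower_moment i3; rewrite ltnW.
have i3a := integrable_abs_moment i3.
pose M := \int[mu]_u (`|u| ^+ 3).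
(* [v^3 >= (3 v^2 - 1) / 2] for [v >= 0], with equality at [v = 1]; the mean of
   the right-hand side is 1. *)
have M1 : 1 <= M.
  have ip : mu.-integrable [set: R] (EFin \o (fun u => (3 * u ^+ 2 - 1) / 2)).
    have := integrableB measurableT (integrableZl measurableT (3 / 2) (imu 2 isT))
      (finite_measure_integrable_cst mu 2^-1 measurableT).
    apply: eq_integrable => // u _ /=; rewrite -EFinM -EFinB; congr EFin; lra.
  have -> : 1 = \int[mu]_u ((3 * u ^+ 2 - 1) / 2).
    transitivity (\int[mu]_u (3 / 2 * u ^+ 2 - 2^-1)).
      rewrite RintegralB//; first last.
      - exact: finite_measure_integrable_cst.
      - exact: (integrableZl measurableT (3 / 2) (imu 2 isT)).
      rewrite RintegralZl//; last exact: (imu 2 isT).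
      by rewrite m2 Rintegral_constant; lra.
    by apply: eq_Rintegral => u _; lra.
  apply: le_Rintegral => // u _.
  rewrite -(real_normK (num_real u)); set v := `|u|.
  have v0 : 0 <= v := normr_ge0 u.
  have : 0 <= (v - 1) ^+ 2 * (v + 2^-1) by rewrite mulr_ge0 ?sqr_ge0 ?addr_ge0.
  have -> : (v - 1) ^+ 2 * (v + 2^-1) = v ^+ 3 - (3 * v ^+ 2 - 1) / 2 by field.
  by rewrite subr_ge0.
apply: (@le_trans _ _ (\sum_(i <- sites N m) 24 * n%:R ^+ 3 * M * kap i ^+ 3)).
  apply: (le_trans (truncated_lindeberg m imu _)).
    case=> [|[|[|//]]] _; rewrite ?gaussian_moment1 ?gaussian_moment2//.
    by rewrite gaussian_moment0; under eq_Rintegral do rewrite expr0;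
      rewrite Rintegral_constant.
  apply: ler_sum => i _.
  have c0 : 0 <= (2 * n%:R) ^+ 3 * kap i ^+ 3.
    by rewrite mulr_ge0// exprn_ge0// ?kap_ge0// mulr_ge0.
  have rho_le (lam : probability R R) :
      lam.-integrable [set: R] (fun u => (u ^+ 2)%:E) ->
      lam.-integrable [set: R] (EFin \o (fun u => `|u| ^+ 3)) ->
      \int[lam]_u remainder_bound 2 (2 * n%:R * kap i * u) <=
      (2 * n%:R) ^+ 3 * kap i ^+ 3 * \int[lam]_u (`|u| ^+ 3).
    move=> l2 l3; rewrite -RintegralZl//; apply: le_Rintegral => //.
    - exact: mrho.
    - exact: (integrableZl measurableT _ l3).
    by move=> u _; rewrite /remainder_bound ge_min scale_pow// lexx.
  rewrite (_ : 24 * _ * M * _ = (2 * n%:R) ^+ 3 * kap i ^+ 3 * M +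
    (2 * n%:R) ^+ 3 * kap i ^+ 3 * (2 * M)); last by ring.
  apply: lerD; first by apply: rho_le => //; exact: imu.
  apply: (le_trans (rho_le _ (integrable_gaussian R 2)
    (integrable_abs_moment (integrable_gaussian R 3)))).
  rewrite ler_wpM2l// (le_trans (gaussian_abs_moment3 R))//.
  by rewrite ler_pMr.
rewrite -mulr_sumr -[leRHS]mulrA ler_wpM2l//.
  by rewrite !mulr_ge0 ?exprn_ge0// (le_trans ler01).
rewrite -powRN; apply: sum_sites_coef_bound => // p p2.
have [p4|p4] := ltnP p 4; first by left; apply: b23; rewrite p2.
by right; have : 4 <= p%:R :> R; [rewrite ler_nat|lra].
Qed.

(** The remainder for [mu] is split at [theta = N^(1/4)]: below, the fifth power is
    at most [theta] times the fourth.  For the Gaussian the fifth power is used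
    throughout, and its mean, at most [9], is absorbed in [3 M], where [M = 3] is
    the common fourth moment.  The powers [2^4] and [2^5] of [2 n] give the
    constants [2 * 16] and [4 * 32].  The factor [theta] lowers the gain
    [N^(-1/2)] of the fifth powers to [N^(-1/4)]. *)
Lemma truncated_gap_fifth m :
  (forall j, (j <= 4)%N -> mu.-integrable [set: R] (fun u => (u ^+ j)%:E)) ->
  (forall j, (j <= 4)%N -> \int[mu]_u (u ^+ j) = \int[nu]_u (u ^+ j)) ->
  gap m <=
    32 * n%:R ^+ 4 * \int[mu]_u (`|u| ^+ 4 * \1_[set v | N%:R `^ (1 / 4) <= `|v|] u) *
      \sum_(2 <= p < m) (beta1 p + beta2 p) ^+ 4 +
    128 * n%:R ^+ 5 * \int[mu]_u (`|u| ^+ 4) * (N%:R `^ (1 / 4))^-1 *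
      \sum_(2 <= p < m) (beta1 p + beta2 p) ^+ 5.
Proof.
move=> imu mu_nu.
pose theta : R := N%:R `^ (1 / 4); pose tail : set R := [set v | theta <= `|v|].
have theta_gt0 : 0 < theta by rewrite powR_gt0// ltr0n.
have i4 := integrable_abs_moment (imu 4%N isT).
have it := integrable_tail theta i4.
pose M := \int[mu]_u (`|u| ^+ 4).
pose tau := \int[mu]_u (`|u| ^+ 4 * \1_tail u).
have M3 : M = 3.
  rewrite -(gaussian_moment4 R) -mu_nu//; apply: eq_Rintegral => u _.
  by rewrite -normrX ger0_norm// exprn_even_ge0.
have tau0 : 0 <= tau.
  by apply: Rintegral_ge0 => u _; rewrite mulr_ge0 ?exprn_ge0// indicE.
apply: (@le_trans _ _ (\sum_(i <- sites N m) (32 * n%:R ^+ 4 * tau * kap i ^+ 4 +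
    128 * n%:R ^+ 5 * M * theta * kap i ^+ 5))).
  apply: (le_trans (truncated_lindeberg m imu mu_nu)).
  apply: ler_sum => i _.
  pose c q := (2 * n%:R) ^+ q * kap i ^+ q.
  have c0 q : 0 <= c q by rewrite mulr_ge0// exprn_ge0// ?kap_ge0// mulr_ge0.
  have rho_mu : \int[mu]_u remainder_bound 4 (2 * n%:R * kap i * u) <=
      c 5 * theta * M + 2 * c 4 * tau.
    have j1 := integrableZl measurableT (c 5 * theta) i4.
    have j2 := integrableZl measurableT (2 * c 4) it.
    rewrite -!RintegralZl// -RintegralD//; apply: le_Rintegral => //.
    - by apply: mrho; exact: imu.
    - exact: (integrableD measurableT j1 j2).
    move=> u _; rewrite /remainder_bound ge_min !scale_pow// -/(c 4) -/(c 5).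
    have t0 : 0 <= c 5 * theta * `|u| ^+ 4.
      by apply: mulr_ge0; [apply: mulr_ge0; [exact: c0|exact: ltW]|exact: exprn_ge0].
    rewrite indicE; have [ut|ut] := boolP (u \in tail).
      by apply/orP; right; rewrite mulr1 mulrA lerDr.
    apply/orP; left; rewrite !mulr0 addr0 exprS mulrA ler_wpM2r ?exprn_ge0//.
    rewrite ler_wpM2l// ltW// ltNge; apply: contra ut => ut.
    by rewrite inE.
  have g5 := integrable_abs_moment (integrable_gaussian R 5).
  have rho_nu : \int[nu]_u remainder_bound 4 (2 * n%:R * kap i * u) <= c 5 * 9.
    apply: (@le_trans _ _ (c 5 * \int[nu]_u (`|u| ^+ 5))); last first.
      by rewrite ler_wpM2l// gaussian_abs_moment5.
    rewrite -RintegralZl//.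
    apply: le_Rintegral => //.
    - apply: mrho; exact: integrable_gaussian.
    - exact: (integrableZl measurableT _ g5).
    by move=> u _; rewrite /remainder_bound ge_min scale_pow// lexx.
  apply: (le_trans (lerD rho_mu rho_nu)).
  have theta1 : 1 <= theta.
    by rewrite -(powRr0 N%:R) ler_powR ?ler1n// divr_ge0.
  have c5 : c 5 * 9 <= c 5 * theta * M * 3.
    rewrite (_ : c 5 * theta * M * 3 = c 5 * (9 * theta)); last by rewrite M3; ring.
    by apply: ler_wpM2l; [exact: c0|lra].
  rewrite (_ : 32 * _ * tau * _ + _ =
      2 * c 4 * tau + (c 5 * theta * M + c 5 * theta * M * 3)).
    by lra.
  by rewrite /c; ring.
rewrite big_split/= -!mulr_sumr; apply: lerD.
  rewrite ler_wpM2l ?mulr_ge0 ?exprn_ge0//.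
  rewrite -[leRHS]mul1r -(powRr0 N%:R); apply: sum_sites_coef_bound => // p p2.
  by right; have : 2 <= p%:R :> R; [rewrite ler_nat|lra].
rewrite -(mulrA (_ * M)) -[leRHS](mulrA (_ * M)) ler_wpM2l//.
  by rewrite !mulr_ge0 ?exprn_ge0// M3.
rewrite -ler_pdivlMl// mulrA -powRN -powRD; last first.
  by rewrite pnatr_eq0 -lt0n N_gt0 implybT.
apply: sum_sites_coef_bound => // p p2.
by right; have : 2 <= p%:R :> R; [rewrite ler_nat|lra].
Qed.

End truncated_comparison.

(** * Removing the truncation *)

Lemma partial_sum_lee (R : realType) (a : nat -> R) (c : R) k m :
  0 <= c -> (forall p, (k <= p)%N -> 0 <= a p) ->
  ((c * \sum_(k <= p < m) a p)%:E <= c%:E * \sum_(k <= p <oo) (a p)%:E)%E.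
Proof.
move=> c0 a0; rewrite EFinM -sumEFin lee_wpmul2l ?lee_fin//.
by apply: nneseries_lim_ge => p kp _; rewrite lee_fin a0.
Qed.

(** The right-hand side is extended real because the series over [p] that it
    contains may be infinite. *)
Lemma cvg_dist_lee (R : realType) (u v : nat -> R) (a b : R) (B : \bar R) :
  u @ \oo --> a -> v @ \oo --> b ->
  (forall m, (`|u m - v m|%:E <= B)%E) -> (`|a%:E - b%:E| <= B)%E.
Proof.
move=> ua vb uvB; rewrite -EFinB abse_EFin.
have uv : (fun m => `|u m - v m|%:E) @ \oo --> `|a - b|%:E.
  by apply: cvg_EFin; [exact: nearW|apply: cvg_norm; exact: cvgB].
rewrite -(cvg_lim _ uv)//; apply: lime_le; first by apply/cvg_ex; eexists; exact: uv.
exact: nearW.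
Qed.

(** The moments of [y] as moments of its law, which is what the comparison of the
    truncated models speaks of. *)
Section pushed_expectations.
Context d (T : measurableType d) (R : realType) (Q : probability T R).
Variable y : {RV Q >-> R}.
Let mu : probability R R := distribution Q y.

Lemma ge0_expectation_distribution (f : R -> R) : measurable_fun [set: R] f ->
  (forall u, 0 <= f u) ->
  ('E_Q[fun w => f (y w)] = \int[mu]_u (f u)%:E)%E.
Proof.
move=> mf f0; rewrite unlock ge0_integral_distribution//.
exact/measurable_EFinP.
Qed.

Lemma expectation_distribution (f : R -> R) :
  mu.-integrable [set: R] (EFin \o f) ->
  ('E_Q[fun w => f (y w)] = (\int[mu]_u f u)%:E)%E.
Proof.
move=> fi; rewrite unlock /Rintegral fineK; last exact: integrable_fin_num fi.
rewrite integral_distribution//; first by case/integrableP: fi.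
exact: (integrable_law (lam := mu) (Z := y) (fun B _ => erefl) fi).
Qed.

Lemma integrable_distribution_ge0 (f : R -> R) : measurable_fun [set: R] f ->
  (forall u, 0 <= f u) -> ('E_Q[fun w => f (y w)] < +oo)%E ->
  mu.-integrable [set: R] (EFin \o f).
Proof.
move=> mf f0; rewrite ge0_expectation_distribution// => foo.
apply/integrableP; split; first exact/measurable_EFinP.
by under eq_integral do rewrite /= ger0_norm//.
Qed.

Lemma standardized_moments : ('E_Q[y] = 0)%E -> ('V_Q[y] = 1)%E ->
  [/\ mu.-integrable [set: R] (fun u => (u ^+ 2)%:E),
      \int[mu]_u (u ^+ 1) = 0 & \int[mu]_u (u ^+ 2) = 1].
Proof.
move=> y0; rewrite /variance unlock y0 => y2.
have {}y2 : ('E_Q[fun w => (y w ^+ 2)%R] = 1)%E.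
  rewrite -y2; congr expectation; apply/funext => w /=.
  by transitivity ((y w - 0) * (y w - 0)); first by rewrite subr0 expr2.
have i2 : mu.-integrable [set: R] (fun u => (u ^+ 2)%:E).
  apply: integrable_distribution_ge0 => //; first by move=> u; exact: sqr_ge0.
  by rewrite y2 ltry.
split=> //; apply: EFin_inj.
  have i1 := integrable_lower_moment (leqnSn 1) i2.
  by rewrite -(expectation_distribution (f := fun u => u ^+ 1) i1).
by rewrite -(expectation_distribution (f := fun u => u ^+ 2) i2).
Qed.

End pushed_expectations.

Theorem theorem7 (R : realType)
    (N n : nat) (N_ge1 : (1 <= N)%N) (n_ge1 : (1 <= n)%N)
    (beta1 beta2 t : nat -> R) (h1 h2 : R)
    (beta1_ge0 : forall p, (2 <= p)%N -> 0 <= beta1 p)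
    (beta2_ge0 : forall p, (2 <= p)%N -> 0 <= beta2 p)
    (beta1_sum : (\sum_(2 <= p <oo) (2 ^+ p * beta1 p ^+ 2)%:E < +oo)%E)
    (beta2_sum : (\sum_(2 <= p <oo) (2 ^+ p * beta2 p ^+ 2)%:E < +oo)%E)
    (t_01 : forall p, (2 <= p)%N -> 0 <= t p <= 1)
    (d0 : measure_display) (T0 : measurableType d0) (Q : probability T0 R)
    (y : {RV Q >-> R})
    (y_mean : ('E_Q[y] = 0)%E) (y_var : ('V_Q[y] = 1)%E)
    (* i.i.d. disorder with the law of y *)
    (d : measure_display) (T : measurableType d) (P : probability T R)
    (Y : site N -> {RV P >-> R})
    (Y_iid : iid_disorder Y (distribution Q y))
    (* i.i.d. standard Gaussian disorder *)
    (d' : measure_display) (T' : measurableType d') (P' : probability T' R)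
    (G : site N -> {RV P' >-> R})
    (G_iid : iid_disorder G (normal_prob 0 1))
    (L : {ffun 'I_n -> config N * config N} -> R)
    (L_le1 : forall r, `|L r| <= 1) :
  let EG :=
    ('E_P'[fun w => gibbs_mean (fun i => G i w) t beta1 beta2 h1 h2 L])%E in
  let EY :=
    ('E_P[fun w => gibbs_mean (fun i => Y i w) t beta1 beta2 h1 h2 L])%E in
  (beta1 2%N = 0 -> beta1 3%N = 0 -> beta2 2%N = 0 -> beta2 3%N = 0 ->
   ('E_Q[fun w => (`|y w| ^+ 3)%R] < +oo)%E ->
   (`|EG - EY| <=
     (3 * n%:R * (Ccst 2 (2 * n))%:R)%:E * 'E_Q[fun w => (`|y w| ^+ 3)%R] *
     ((N%:R `^ (1 / 2))^-1)%:E *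
     \sum_(4 <= p <oo) ((beta1 p + beta2 p) ^+ 3)%:E)%E)
  /\
  ((forall k, (1 <= k <= 4)%N ->
      ('E_Q[fun w => (y w ^+ k)%R] = \int[normal_prob 0 1]_u (u ^+ k)%:E)%E) ->
   (`|EG - EY| <=
     (4 * n%:R * (Ccst 3 (2 * n))%:R)%:E *
     'E_Q[fun w => (`|y w| ^+ 4 *
            \1_[set w' | N%:R `^ (1 / 4) <= `|y w'|] w)%R] *
     \sum_(2 <= p <oo) ((beta1 p + beta2 p) ^+ 4)%:E +
     (5 * n%:R * (Ccst 4 (2 * n))%:R)%:E * 'E_Q[fun w => (`|y w| ^+ 4)%R] *
     ((12 * N%:R `^ (1 / 4))^-1)%:E *
     \sum_(2 <= p <oo) ((beta1 p + beta2 p) ^+ 5)%:E)%E).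
Proof.
move=> EG EY.
pose mu : probability R R := distribution Q y.
have [i2 m1 m2] := standardized_moments y_mean y_var.
have imu j : (j <= 2)%N -> mu.-integrable [set: R] (fun u => (u ^+ j)%:E).
  by move=> j2; exact: integrable_lower_moment j2 i2.
have [Y_indep Y_law] := Y_iid; have [G_indep G_normal] := G_iid.
have G_law i : active i ->
    forall B, measurable B -> distribution P' (G i) B = gaussian_law R B.
  by move=> ai B mB; rewrite G_normal// gaussian_lawE.
have inu j : (j <= 2)%N -> (gaussian_law R).-integrable [set: R] (fun u => (u ^+ j)%:E).
  by move=> _; exact: integrable_gaussian.
pose gm d1 (T1 : measurableType d1) (P1 : probability T1 R)
    (Z : site N -> {RV P1 >-> R}) :=
  \int[P1]_w gibbs_mean (fun i => Z i w) t beta1 beta2 h1 h2 L.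
have EGE : EG = (gm _ _ _ G)%:E by exact: expectation_gibbs_mean.
have EYE : EY = (gm _ _ _ Y)%:E by exact: expectation_gibbs_mean.
have cG := cvg_truncated_mean (h1 := h1) (h2 := h2) N_ge1 G_indep G_law inu
  (gaussian_moment1 R) (gaussian_moment2 R) t_01
  beta1_ge0 beta2_ge0 beta1_sum beta2_sum L_le1.
have cY := cvg_truncated_mean (h1 := h1) (h2 := h2) N_ge1 Y_indep Y_law imu m1 m2 t_01
  beta1_ge0 beta2_ge0 beta1_sum beta2_sum L_le1.
have b_ge0 p : (2 <= p)%N -> 0 <= beta1 p + beta2 p.
  by move=> p2; rewrite addr_ge0 ?beta1_ge0 ?beta2_ge0.
have sum_lee q k m (c : R) : (2 <= k)%N -> 0 <= c ->
    ((c * \sum_(k <= p < m) (beta1 p + beta2 p) ^+ q)%:E <=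
     c%:E * \sum_(k <= p <oo) ((beta1 p + beta2 p) ^+ q)%:E)%E.
  move=> k2 c0; apply: partial_sum_lee => // p kp.
  by rewrite exprn_ge0// b_ge0// (leq_trans k2).
rewrite EGE EYE; split.
  move=> b12 b13 b22 b23 y3.
  have m3 : measurable_fun [set: R] (fun u : R => `|u| ^+ 3).
    by apply: measurable_funX; exact: normr_measurable.
  have i3a : mu.-integrable [set: R] (EFin \o (fun u => `|u| ^+ 3)).
    by apply: integrable_distribution_ge0 => // u; rewrite exprn_ge0.
  have i3 : mu.-integrable [set: R] (fun u => (u ^+ 3)%:E).
    apply: le_integrable i3a => //; first exact/measurable_EFinP.
    by move=> u _ /=; rewrite lee_fin !normrX normr_id.
  rewrite (expectation_distribution (f := fun u => `|u| ^+ 3) i3a).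
  have b_low p : (2 <= p < 4)%N -> beta1 p + beta2 p = 0.
    by case: p => [|[|[|[|]]]]// _; rewrite ?b12 ?b22 ?b13 ?b23 addr0.
  apply: (cvg_dist_lee cG cY) => m.
  have := truncated_gap_third Y_indep G_indep Y_law G_law h1 h2 N_ge1 n_ge1
    beta1_ge0 beta2_ge0 t_01 L_le1 m i3 m1 m2 b_low.
  rewrite -lee_fin => /le_trans; apply.
  have -> : \sum_(2 <= p < m) (beta1 p + beta2 p) ^+ 3 =
      \sum_(4 <= p < m) (beta1 p + beta2 p) ^+ 3.
    rewrite [RHS](@big_nat_widenl _ _ _ 4 2)// [RHS]big_mkcond/=.
    rewrite big_nat_cond [RHS]big_nat_cond; apply: eq_bigr => p.
    rewrite andbT => /andP[p2 _]; case: ltnP => // p4.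
    by rewrite b_low ?p2// expr0n.
  rewrite -!EFinM; apply: le_trans (sum_lee 3 4 m _ isT _).
    rewrite lee_fin ler_wpM2r//.
      rewrite big_nat_cond sumr_ge0// => p /andP[/andP[p4 _] _].
      by rewrite exprn_ge0// b_ge0// (leq_trans _ p4).
    rewrite ler_wpM2r ?invr_ge0 ?powR_ge0// ler_wpM2r//.
      by apply: Rintegral_ge0 => u _; rewrite exprn_ge0.
    rewrite /Ccst -[((2 * 3)./2)%N]/3%N -natrX -!natrM ler_nat.
    nia.
  rewrite !mulr_ge0 ?invr_ge0 ?powR_ge0//.
  by apply: Rintegral_ge0 => u _; rewrite exprn_ge0.
move=> y_moments.
pose theta : R := N%:R `^ (1 / 4); pose tail : set R := [set v | theta <= `|v|].
have y_momentE k : (1 <= k <= 4)%N ->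
    ('E_Q[fun w => (y w ^+ k)%R] = (\int[gaussian_law R]_u (u ^+ k))%:E)%E.
  move=> k14; rewrite y_moments// gaussian_momentE /Rintegral fineK//.
  exact: integrable_fin_num (integrable_normal_moment R k).
have i4 : mu.-integrable [set: R] (fun u => (u ^+ 4)%:E).
  apply: (integrable_distribution_ge0 (f := fun u => u ^+ 4)) => //.
    by move=> u; rewrite exprn_even_ge0.
  by rewrite y_momentE ?ltry.
have imu4 j : (j <= 4)%N -> mu.-integrable [set: R] (fun u => (u ^+ j)%:E).
  by move=> j4; exact: integrable_lower_moment j4 i4.
have mu_nu j : (j <= 4)%N ->
    \int[mu]_u (u ^+ j) = \int[gaussian_law R]_u (u ^+ j).
  case: j => [_|j j4].
    by rewrite gaussian_moment0; under eq_Rintegral do rewrite expr0;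
      rewrite Rintegral_constant.
  apply: EFin_inj; rewrite -y_momentE//.
  by rewrite (expectation_distribution (f := fun u => u ^+ j.+1) (imu4 _ j4)).
have i4a := integrable_abs_moment i4.
have it := integrable_tail theta i4a.
rewrite (expectation_distribution (f := fun u => `|u| ^+ 4) i4a).
rewrite (expectation_distribution (f := fun u => `|u| ^+ 4 * \1_tail u) it).
apply: (cvg_dist_lee cG cY) => m.
have := truncated_gap_fifth Y_indep G_indep Y_law G_law h1 h2 N_ge1 n_ge1
  beta1_ge0 beta2_ge0 t_01 L_le1 m imu4 mu_nu.
rewrite -lee_fin => /le_trans; apply; rewrite EFinD -!EFinM.
have tail0 : 0 <= \int[mu]_u (`|u| ^+ 4 * \1_tail u).
  by apply: Rintegral_ge0 => u _; rewrite mulr_ge0 ?exprn_ge0// indicE.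
have M0 : 0 <= \int[mu]_u (`|u| ^+ 4).
  by apply: Rintegral_ge0 => u _; rewrite exprn_ge0.
have S0 q : 0 <= \sum_(2 <= p < m) (beta1 p + beta2 p) ^+ q.
  rewrite big_nat_cond sumr_ge0// => p /andP[/andP[p2 _] _].
  by rewrite exprn_ge0// b_ge0.
apply: leeD.
  apply: le_trans (sum_lee 4 2 m _ isT _); last by rewrite !mulr_ge0.
  rewrite lee_fin ler_wpM2r// ler_wpM2r//.
  rewrite /Ccst -[((3 * 4)./2)%N]/6%N -natrX -!natrM ler_nat.
  nia.
apply: le_trans (sum_lee 5 2 m _ isT _); last first.
  by rewrite !mulr_ge0 ?invr_ge0 ?mulr_ge0 ?powR_ge0.
rewrite lee_fin ler_wpM2r// invfM [leRHS]mulrA ler_wpM2r ?invr_ge0 ?powR_ge0//.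
rewrite [leRHS]mulrAC ler_wpM2r// ler_pdivlMr//.
rewrite /Ccst -[((4 * 5)./2)%N]/10%N -natrX -!natrM ler_nat.
nia.
Qed.
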